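(* Let $X$ be a perfect Polish space and $f\colon X\to X$ a continuous map. Let $Q$ be a $G_\delta$, hereditary subset of $C(X)$ and let $\alpha_Q=\{R_n^Q\}_{n\in\mathbb{N}}$ be the coherent list on $X$ associated with $Q$. Then the following conditions are equivalent: (1) $\{A\in C(X)\colon \bigcup_{i=0}^N f^i(A)\in Q \text{ for all } N=1,2,\dotsc\}$ is a dense $G_\delta$ subset of $C(X)$; (2) there exists a sequence $\{A_i\}_{i\ge 1}$ in $CANTOR(X)$, dense in $CANTOR(X)$, such that $\bigcup_{j=0}^N\bigcup_{i=1}^N f^j(A_i)\in Q$ for all $N\geq 1$; (3) for every $n=1,2,\dotsc$, the set $\{(x_1,\dotsc,x_n)\in X^n\colon \bigcup_{i=0}^N f^i(\{x_1,\dotsc,x_n\})\in Q \text{ for all } N=1,2,\dotsc\}$ is a dense $G_\delta$ subset of $X^n$; (4) there exists a dense, countable, $f$-invariant, $\alpha_Q$-dependent set in $X$; (5) there exists a $c$-dense, $F_\sigma$, $f$-invariant, $\alpha_Q$-dependent set in $X$; (6) there exists a nowhere meager, $f$-invariant, $\alpha_Q$-dependent set in $X$.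
   Context: $\mathbb{N}=\{1,2,\dotsc\}$. Let $d$ be a bounded compatible complete metric on the Polish space $X$. $C(X)$ is the collection of non-empty compact subsets of $X$, with the topology of the Hausdorff metric; $CANTOR(X)\subset C(X)$ is the collection of Cantor sets in $X$ (subsets homeomorphic to the standard middle-third Cantor set), with the subspace topology. A space is perfect if it has no isolated points. A subset $Q\subset C(X)$ is hereditary if $A\in Q$ implies that every non-empty compact subset of $A$ belongs to $Q$. The coherent list associated with $Q$ is $\alpha_Q=\{R_n^Q\}_{n\in\mathbb{N}}$, where $R_n^Q\subset X^n$ is the set of $n$-tuples $(x_1,\dotsc,x_n)$ such that $\{x_1,\dotsc,x_n\}\in Q$. A subset $A\subset X$ is $\alpha_Q$-dependent if for any $n\in\mathbb{N}$ and any pairwise distinct $x_1,\dotsc,x_n\in A$ one has $(x_1,\dotsc,x_n)\in R_n^Q$. A subset $A\subset X$ is $f$-invariant if $f(A)\subset A$; $c$-dense if $A\cap U$ has the cardinality of the continuum for every non-empty open $U\subset X$; nowhere meager if $A\cap U$ is not meager for every non-empty open $U\subset X$. *)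

(* Defs.v *)
From HB Require Import structures.
From mathcomp Require Import all_boot all_order all_algebra.
From mathcomp Require Import all_classical all_reals all_analysis borel_hierarchy.

Set Implicit Arguments.
Unset Strict Implicit.
Unset Printing Implicit Defensive.

Import Order.TTheory GRing.Theory Num.Theory.
Import numFieldTopology.Exports.

Local Open Scope classical_set_scope.
Local Open Scope ring_scope.

(* [Complete] is pointed, so these metric spaces are nonempty. *)
#[short(type="completeMetricType")]
HB.structure Definition CompleteMetric (K : numDomainType) :=
  {T of Metric K T & Complete T}.

Definition bounded_metric (R : realType) (X : metricType R) :=
  exists M : R, forall x y : X, mdist x y <= M.

Definition separable (T : topologicalType) :=
  exists2 D : set T, countable D & dense D.

Definition homeomorphic (T U : topologicalType) :=
  exists (g : T -> U) (h : U -> T),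
    [/\ continuous g, continuous h, cancel g h & cancel h g].

Definition nowhere_dense (T : topologicalType) (A : set T) :=
  interior (closure A) = set0.

Definition meager (T : topologicalType) (A : set T) :=
  exists2 F : nat -> set T,
    (forall n, nowhere_dense (F n)) & A = \bigcup_n F n.

Definition nowhere_meager (T : topologicalType) (A : set T) :=
  forall U : set T, open U -> U !=set0 -> ~ meager (A `&` U).

Definition c_dense (R : realType) (T : topologicalType) (A : set T) :=
  forall U : set T, open U -> U !=set0 -> (A `&` U #= [set: R])%card.

Definition invariant_set (T : Type) (f : T -> T) (A : set T) := f @` A `<=` A.

Section middle_third.
Variable R : realType.

Fixpoint middle_third_step (n : nat) : set R :=
  if n is m.+1 then
    [set x / 3 | x in middle_third_step m] `|`
    [set (2 + x) / 3 | x in middle_third_step m]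
  else [set x | 0 <= x <= 1].

Definition middle_third : set R := \bigcap_n middle_third_step n.

End middle_third.
Arguments middle_third R : clear implicits.

Record compacts (T : topologicalType) := Compacts {
  carrier :> set T;
  carrier_compact : compact carrier;
  carrier_nonempty : carrier !=set0
}.

Lemma compacts_inj (T : topologicalType) (A B : compacts T) :
  A = B :> set T -> A = B.
Proof.
case: A B => [A cA nA] [B cB nB] /= AB; move: cA nA; rewrite AB => cA nA.
by congr Compacts; exact: Prop_irrelevance.
Qed.

HB.instance Definition _ (T : topologicalType) := gen_eqMixin (compacts T).
HB.instance Definition _ (T : topologicalType) := gen_choiceMixin (compacts T).

Section hausdorff_metric.
Variables (R : realType) (X : metricType R).
Implicit Types (x y : X) (A B C : compacts X).

Definition dist_to x (B : set X) : R := inf [set mdist x y | y in B].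

Definition excess (A B : set X) : R := sup [set dist_to x B | x in A].

Definition hausdorff_dist A B : R := Num.max (excess A B) (excess B A).

Lemma has_inf_dist x B : has_inf [set mdist x y | y in (B : set X)].
Proof.
split; first by have [y By] := carrier_nonempty B; exists (mdist x y), y.
by exists 0 => _ [y _ <-]; exact: mdist_ge0.
Qed.

Lemma dist_to_le x y B : (B : set X) y -> dist_to x B <= mdist x y.
Proof. by move=> By; apply: ge_inf; [exact: (has_inf_dist x B).2|exists y]. Qed.

Lemma le_dist_to x B (c : R) :
  (forall y, (B : set X) y -> c <= mdist x y) -> c <= dist_to x B.
Proof.
move=> h; apply: lb_le_inf; first exact: (has_inf_dist x B).1.
by move=> _ [y By <-]; exact: h.
Qed.

Lemma dist_to_ge0 x B : 0 <= dist_to x B.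
Proof. by apply: le_dist_to => y _; exact: mdist_ge0. Qed.

Lemma dist_to_triangle x y B : dist_to x B <= mdist x y + dist_to y B.
Proof.
rewrite -lerBlDl; apply: le_dist_to => z Bz; rewrite lerBlDl.
exact: le_trans (dist_to_le x Bz) (metric_triangle _ _ _).
Qed.

Lemma compact_mdist_bounded y A :
  exists M : R, forall x, (A : set X) x -> mdist x y <= M.
Proof.
have /compact_near_coveringP cA := @carrier_compact _ A.
have : \forall M \near +oo, (A : set X) `<=` [set x | mdist x y <= M].
  apply: (cA R _ (fun M x => mdist x y <= M)) => x _.
  exists (ball x 1, [set M | 1 + mdist x y <= M]).
    by split; [exact: nbhsx_ballx|apply: nbhs_pinfty_ge; exact: num_real].
  move=> [x' M] [/=]; rewrite ballEmdist/= => xx' /(le_trans _); apply.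
  by rewrite (le_trans (metric_triangle _ x _))// lerD2r metric_sym ltW.
by move=> [M [_ /(_ (M + 1))]]; rewrite ltrDl ltr01 => /(_ isT) h; exists (M + 1).
Qed.

Lemma has_sup_dist_to A B : has_sup [set dist_to x B | x in (A : set X)].
Proof.
split; first by have [x Ax] := carrier_nonempty A; exists (dist_to x B), x.
have [y By] := carrier_nonempty B.
have [M AM] := compact_mdist_bounded y A; exists M => _ [x Ax <-].
exact: le_trans (dist_to_le x By) (AM x Ax).
Qed.

Lemma dist_to_le_excess x A B : (A : set X) x -> dist_to x B <= excess A B.
Proof.
by move=> Ax; apply: ub_le_sup; [exact: (has_sup_dist_to A B).2|exists x].
Qed.

Lemma excess_le A B (c : R) :
  (forall x, (A : set X) x -> dist_to x B <= c) -> excess A B <= c.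
Proof.
move=> h; apply: ge_sup; first exact: (has_sup_dist_to A B).1.
by move=> _ [x Ax <-]; exact: h.
Qed.

Lemma excess_ge0 A B : 0 <= excess A B.
Proof.
have [x Ax] := carrier_nonempty A.
exact: le_trans (dist_to_ge0 x B) (dist_to_le_excess B Ax).
Qed.

Lemma excess_triangle B A C : excess A C <= excess A B + excess B C.
Proof.
apply: excess_le => x Ax.
apply: (@le_trans _ _ (dist_to x B + excess B C)).
  rewrite -lerBlDr; apply: le_dist_to => y By; rewrite lerBlDr.
  by rewrite (le_trans (dist_to_triangle x y C))// lerD2l dist_to_le_excess.
by rewrite lerD2r dist_to_le_excess.
Qed.

Lemma excess0_sub A B : excess A B = 0 -> (A : set X) `<=` B.
Proof.
move=> AB0 x Ax.
have clB : closed (B : set X).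
  by apply: compact_closed; [exact: metric_hausdorff|exact: carrier_compact].
apply: clB => U /nbhs_ballP[e /= e0 eU].
have xB0 : dist_to x B < e.
  by rewrite (le_lt_trans (dist_to_le_excess B Ax))// AB0.
have [_ [y By <-] xye] := inf_lt (has_inf_dist x B).1 xB0.
by exists y; split=> //; apply: eU; rewrite ballEmdist.
Qed.

Lemma hausdorff_distxx A : hausdorff_dist A A = 0.
Proof.
rewrite /hausdorff_dist maxxx; apply/eqP; rewrite eq_le excess_ge0 andbT.
by apply: excess_le => x Ax; rewrite -(mdistxx x) dist_to_le.
Qed.

Lemma hausdorff_dist_positivity A B : hausdorff_dist A B = 0 -> A = B.
Proof.
move=> AB0; have := le_refl (hausdorff_dist A B).
rewrite {2}AB0 ge_max => /andP[AB BA]; apply: compacts_inj.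
apply/seteqP; split; apply: excess0_sub; apply/eqP;
  by rewrite eq_le excess_ge0 ?AB ?BA.
Qed.

Lemma hausdorff_dist_sym A B : hausdorff_dist A B = hausdorff_dist B A.
Proof. exact: maxC. Qed.

Lemma hausdorff_dist_triangle B A C :
  hausdorff_dist A C <= hausdorff_dist A B + hausdorff_dist B C.
Proof.
rewrite ge_max; apply/andP; split.
  by rewrite (le_trans (excess_triangle B A C))// lerD// le_max lexx.
by rewrite (le_trans (excess_triangle B C A))// addrC lerD// le_max lexx orbT.
Qed.

HB.instance Definition _ := isMetric.Build R (compacts X)
  hausdorff_distxx hausdorff_dist_positivity hausdorff_dist_sym
  hausdorff_dist_triangle.

End hausdorff_metric.

Section compact_families.
Variable X : topologicalType.
Implicit Types (Q : set (compacts X)) (A : set X) (n : nat).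

(* [S \in Q] for a bare subset [S] of [X]; in particular [S] is then compact
   and nonempty. *)
Definition in_family Q (S : set X) := exists2 K : compacts X, Q K & K = S :> set X.

Definition hereditary Q :=
  forall A B : compacts X, Q A -> (B : set X) `<=` A -> Q B.

Definition power n := prod_topology (fun _ : 'I_n => X).

(* A list [R_1, R_2, ...] of relations, [R_n] being a subset of [X^n]; the
   component of index [0] is never used. *)
Definition relation_list := forall n, set (power n).

Definition coherent_list Q : relation_list :=
  fun n => [set x : power n | in_family Q (range x)].

Definition dependent_set (alpha : relation_list) A :=
  forall n (x : power n), (0 < n)%N ->
    injective x -> (forall i, A (x i)) -> alpha n x.

End compact_families.

Definition cantor_sets (R : realType) (X : topologicalType) : set (compacts X) :=
  [set K : compacts X | homeomorphic (K : set X) (middle_third R)].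
Arguments cantor_sets R X : clear implicits.

(* Main.v *)
Require Import Defs.
From HB Require Import structures.
From mathcomp Require Import all_boot all_order all_algebra.
From mathcomp Require Import all_classical all_reals all_analysis borel_hierarchy.
From mathcomp Require Import lra.

Set Implicit Arguments.
Unset Strict Implicit.
Unset Printing Implicit Defensive.

Import Order.TTheory GRing.Theory Num.Theory.
Import numFieldTopology.Exports.

Local Open Scope classical_set_scope.
Local Open Scope ring_scope.

(** Call a set good when all its partial orbits belong to [Q]. The six
    statements are compared with a single condition, [finite_orbits_dense]:
    given finitely many nonempty open sets, one can pick a point in each so that
    the finite set of these points is good. Every statement implies it easily,
    since finite sets are dense in the compact sets, subsets of good sets are
    good by heredity, and finite subsets of an invariant dependent set are good;
    for the sequence of Cantor sets one also needs a Cantor set inside every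
    nonempty open set. The sets of the first and third statements are always
    [Gdelta], because a partial orbit depends continuously on the compact set.

    Conversely, a finite set [L] in [Q] has a neighbourhood all of whose compact
    subsets lie in a prescribed open superset [O] of [Q]: such a compact set is
    close to a subset of [L], and [L] has only finitely many subsets, all in [Q]
    by heredity. Writing [Q] as an intersection of open sets and applying this
    to partial orbits of good finite sets that are more and more dense, one gets
    in [general_position] open sets [V k] such that a compact set included in
    [V k] for infinitely many [k] is good, while for every nonempty open [G] and
    some [n], each finite intersection of [V n], [V n.+1], ... meets [G].

    - A Cantor scheme whose levels are successively pushed inside sets [V k]
      gives a Cantor set near any given finite set and inside [V k] for
      infinitely many [k]. Passing to smaller and smaller infinite sets of
      indices makes this work for all the members of a dense sequence of Cantor
      sets ([limsup_cantor_sequence]); their finite unions are then good, and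
      the union of all their orbits is the [c]-dense [Fsigma] set. A countable
      invariant dense subset of it gives the countable set.

    - For the nowhere meager set, fix a nonprincipal ultrafilter [U] on the
      indices and take the points [x] such that the set of all [k] with
      [V k x] belongs to [U], together with their orbits. Finitely many such
      points lie together in [V k] for infinitely many [k], so they form a good
      set. Given a meager set, one builds two points outside it, one of them
      lying in [V k] for [k] in every other block of a partition of the large
      indices into intervals, and the other in the remaining ones; since [U] is
      an ultrafilter, one of the two points belongs to the set
      ([ultra_limit_nowhere_meager]). *)

(** * Metric preliminaries and partial orbits *)

(** The distance, with values typed in [R] itself rather than in the number
    domain underlying [R], so that all distances and radii have one type. *)
Definition dist (R : realType) (X : metricType R) (x y : X) : R := mdist x y.

Section metric_preliminaries.
Variables (R : realType) (X : metricType R).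
Implicit Types (x y : X) (U : set X) (e r : R).

Lemma distC x y : dist x y = dist y x.
Proof. exact: metric_sym. Qed.

Lemma distxx x : dist x x = 0.
Proof. exact: mdistxx. Qed.

Lemma dist_ge0 x y : 0 <= dist x y.
Proof. exact: mdist_ge0. Qed.

Lemma dist_gt0 x y : (0 < dist x y) = (x != y).
Proof. exact: mdist_gt0. Qed.


Lemma dist_triangle x y z : dist x z <= dist x y + dist y z.
Proof. exact: metric_triangle. Qed.

Lemma nbhs_mdist_ex x U :
  nbhs x U <-> exists2 e : R, 0 < e & forall y, dist x y < e -> U y.
Proof. by rewrite -metricType_numDomainType.filter_from_mdist_nbhs. Qed.

Lemma open_mdist_ex U x : open U -> U x ->
  exists2 e : R, 0 < e & forall y, dist x y < e -> U y.
Proof. by move=> oU Ux; apply/nbhs_mdist_ex; exact: open_nbhs_nbhs. Qed.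

Lemma mdist_open U :
  (forall x, U x -> exists2 e : R, 0 < e & forall y, dist x y < e -> U y) ->
  open U.
Proof. by move=> h; rewrite openE => x /h /nbhs_mdist_ex. Qed.

Lemma open_mdist_lt x r : open [set y | dist x y < r].
Proof.
apply: mdist_open => y /= xy; exists (r - dist x y); first by rewrite subr_gt0.
by move=> z yz; have := dist_triangle x y z; lra.
Qed.

Lemma closed_mdist_le x r : closed [set y | dist x y <= r].
Proof.
rewrite -[X in closed X]setCK closedC; apply: mdist_open => y /= /negP.
rewrite -ltNge => xy; exists (dist x y - r); first by rewrite subr_gt0.
move=> z yz /=; apply/negP; rewrite -ltNge.
by have := dist_triangle x z y; rewrite (distC z y); lra.
Qed.

Lemma compact_metric_closed (A : set X) : compact A -> closed A.
Proof. by apply: compact_closed; exact: metric_hausdorff. Qed.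

(** Finitely many positive thresholds have a common positive lower bound. *)
Lemma finite_threshold (I : eqType) (s : seq I) (P : I -> R -> Prop) :
  (forall i e e', P i e -> 0 < e' -> e' <= e -> P i e') ->
  (forall i, i \in s -> exists2 e : R, 0 < e & P i e) ->
  exists2 e : R, 0 < e & forall i, i \in s -> P i e.
Proof.
move=> Pmono; elim: s => [|i s IH] h; first by exists 1.
have [e1 e10 Pe1] := h i (mem_head _ _).
have [j js|e2 e20 Pe2] := IH; first by apply: h; rewrite inE js orbT.
exists (Num.min e1 e2); first by rewrite lt_min e10.
move=> j; rewrite inE => /predU1P[->|/Pe2 Pj].
  by apply: Pmono Pe1 _ _; rewrite ?lt_min ?e10// ge_min lexx.
by apply: Pmono Pj _ _; rewrite ?lt_min ?e10// ge_min lexx orbT.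
Qed.

Lemma hausdorff_le (A B : compacts X) e :
  (forall a, (A : set X) a -> exists2 b, (B : set X) b & dist a b <= e) ->
  (forall b, (B : set X) b -> exists2 a, (A : set X) a & dist b a <= e) ->
  dist A B <= e.
Proof.
move=> AB BA; rewrite (_ : dist A B = hausdorff_dist A B)//.
rewrite /hausdorff_dist ge_max; apply/andP; split; apply: excess_le.
  by move=> a /AB[b Bb]; apply: le_trans; exact: dist_to_le.
by move=> b /BA[a Aa]; apply: le_trans; exact: dist_to_le.
Qed.

Lemma hausdorff_lt (A B : compacts X) e a : dist A B < e -> (A : set X) a ->
  exists2 b, (B : set X) b & dist a b < e.
Proof.
rewrite (_ : dist A B = hausdorff_dist A B)//.
rewrite /hausdorff_dist gt_max => /andP[AB _] Aa.
have : dist_to a B < e by apply: le_lt_trans AB; exact: dist_to_le_excess.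
by move=> /(inf_lt (has_inf_dist a B).1)[_ [b Bb <-]]; exists b.
Qed.

(** A continuous map is uniformly continuous at the points of a compact set. *)
Lemma compact_uniform (f : X -> X) (A : set X) e : continuous f -> compact A ->
  0 < e -> exists2 d : R, 0 < d &
    forall x y, A x -> dist x y < d -> dist (f x) (f y) < e.
Proof.
move=> cf /compact_near_coveringP cA e0.
have : \forall d \near 0^'+, A `<=`
    [set x | forall y, dist x y < d -> dist (f x) (f y) < e].
  apply: (cA R _ (fun d x => forall y, dist x y < d ->
                                       dist (f x) (f y) < e)) => x Ax.
  have /nbhs_mdist_ex[d d0 dP] :
      nbhs x (f @^-1` [set z | dist (f x) z < e / 2]).
    apply: cf; apply/nbhs_mdist_ex; exists (e / 2) => //; lra.
  exists ([set y | dist x y < d / 2], [set t | t < d / 2]) => /=.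
    split; first by apply/nbhs_mdist_ex; exists (d / 2) => //; lra.
    by apply: nbhs_right_lt; lra.
  move=> [x' t] [/= xx' td] y x'y.
  have fxx' : dist (f x) (f x') < e / 2 by apply: dP; lra.
  have fxy : dist (f x) (f y) < e / 2.
    by apply: dP; have := dist_triangle x x' y; lra.
  have := dist_triangle (f x') (f x) (f y).
  by rewrite (distC (f x') (f x)); lra.
move=> H; near (0:R)^'+ => d; exists d; first by near: d; exact: nbhs_right_gt.
by move=> x y Ax; apply: (near H d).
Unshelve. all: by end_near. Qed.

End metric_preliminaries.

Section iteration.
Variables (X : topologicalType) (f : X -> X).
Hypothesis f_continuous : continuous f.

Lemma iter_continuous i : continuous (iter i f).
Proof.
elim: i => [|i IH] x; first exact: cvg_id.
by apply: (continuous_comp (IH x)); exact: f_continuous.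
Qed.

(** The partial orbit of a set: the union of its images under the first [N + 1]
    iterates of [f], the identity included. *)
Definition orbit_upto N (A : set X) : set X := \bigcup_(i < N.+1) iter i f @` A.

Lemma orbit_upto_compact N A : compact A -> compact (orbit_upto N A).
Proof.
move=> cA; rewrite /orbit_upto bigcup_mkord; apply: bigsetU_compact => i _.
apply: continuous_compact => //; apply: continuous_subspaceT.
exact: iter_continuous.
Qed.

Lemma orbit_upto_sub N (A B : set X) : A `<=` B ->
  orbit_upto N A `<=` orbit_upto N B.
Proof. by move=> AB; apply: subset_bigcup => i _; apply: image_subset. Qed.

Lemma orbit_upto_le M N (A : set X) : (M <= N)%N ->
  orbit_upto M A `<=` orbit_upto N A.
Proof.
move=> MN x [i /= iM xi]; exists i => //=.
exact: leq_trans iM _.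
Qed.

Lemma sub_orbit_upto N (A : set X) : A `<=` orbit_upto N A.
Proof. by move=> x Ax; exists 0%N => //; exists x. Qed.

Lemma orbit_upto_nonempty N (A : set X) : A !=set0 -> orbit_upto N A !=set0.
Proof. by move=> [x Ax]; exists x; exact: sub_orbit_upto. Qed.

(** The partial orbit of a nonempty compact set, as such a set. *)
Definition orbit_compacts N (A : compacts X) : compacts X :=
  Compacts (@orbit_upto_compact N A (@carrier_compact _ A))
           (orbit_upto_nonempty N (carrier_nonempty A)).

End iteration.

Section families.
Variables (X : topologicalType) (Q : set (compacts X)).
Hypothesis Q_hereditary : hereditary Q.

Lemma in_familyE (K : compacts X) : in_family Q (K : set X) = Q K.
Proof.
apply/propext; split=> [[K' QK' /compacts_inj <-//]|QK]; by exists K.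
Qed.

(** Heredity, in terms of bare subsets. *)
Lemma in_family_sub (A B : set X) :
  in_family Q B -> compact A -> A !=set0 -> A `<=` B -> in_family Q A.
Proof.
move=> [K QK <-] cA nA AK; exists (Compacts cA nA) => //.
exact: Q_hereditary QK _.
Qed.

End families.

Section compact_orbits.
Variables (R : realType) (X : metricType R) (f : X -> X).
Hypothesis f_continuous : continuous f.

(** In the Hausdorff metric the partial orbit depends continuously on the
    compact set. *)
Lemma orbit_compacts_continuous N :
  continuous (orbit_compacts f_continuous N : compacts X -> compacts X).
Proof.
move=> A U /nbhs_mdist_ex[e e0 eU].
have [d d0 dP] : exists2 d : R, 0 < d & forall i : nat, i \in iota 0 N.+1 ->
    forall x y, (A : set X) x -> dist x y < d ->
      dist (iter i f x) (iter i f y) < e / 2.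
  apply: finite_threshold => [i d d' dP d'0 d'd x y Ax xy|i _].
    by apply: dP => //; exact: lt_le_trans d'd.
  apply: compact_uniform; [exact: iter_continuous|exact: carrier_compact|lra].
apply/nbhs_mdist_ex; exists d => // B AB; apply: eU.
apply: (@le_lt_trans _ _ (e / 2)); last lra.
have iotaP i : (i < N.+1)%N -> i \in iota 0 N.+1 by rewrite mem_iota.
apply: hausdorff_le => /= z [i /= iN [x Ax <-]].
  have [y By xy] := hausdorff_lt AB Ax.
  exists (iter i f y); last exact/ltW/(dP _ (iotaP _ iN)).
  by exists i => //; exists y.
have [|y Ay xy] := @hausdorff_lt _ _ B A d x _ Ax; first by rewrite distC.
exists (iter i f y); first by exists i => //; exists y.
by rewrite distC ltW// (dP _ (iotaP _ iN))// distC.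
Qed.

End compact_orbits.

(** * Sequences of open sets in general position *)

(** Dependent choice along an invariant, the step being allowed to depend on
    its rank. *)
Lemma dependent_choice_inv (T : Type) (Inv : T -> Prop)
    (step : nat -> T -> T -> Prop) (x0 : T) :
  Inv x0 -> (forall n x, Inv x -> exists y, Inv y /\ step n x y) ->
  exists u : nat -> T,
    u 0%N = x0 /\ forall n, Inv (u n) /\ step n (u n) (u n.+1).
Proof.
move=> I0 H.
pose nxt n x := if pselect (Inv x) is left h then sval (cid (H n x h)) else x.
pose fix u n := if n is m.+1 then nxt m (u m) else x0.
have uI n : Inv (u n).
  elim: n => //= n IH; rewrite /nxt; case: pselect => // h.
  by case: cid => y [].
exists u; split=> // n; split=> //=; rewrite /nxt.
by case: pselect => [h|/(_ (uI n))//]; case: cid => y [].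
Qed.

Section countable_base.
Variables (R : realType) (X : completeMetricType R).
Hypothesis X_separable : separable X.

Lemma separable_sequence : exists d : nat -> X,
  forall x (e : R), 0 < e -> exists i, dist x (d i) < e.
Proof.
have [D cD dD] := X_separable.
have dist_dense x (e : R) : 0 < e -> exists2 y, D y & dist x y < e.
  move=> e0; have [||y [xy Dy]] := dD [set y | dist x y < e].
  - by exists x; rewrite /= distxx.
  - exact: open_mdist_lt.
  - by exists y.
have /pfcard_geP[D0|[d]] := cD.
  by have [y] := dist_dense point 1 ltr01; rewrite D0.
exists d => x e /(dist_dense x)[y Dy xy].
by have [i _ di] := @surj _ _ _ _ d _ Dy; exists i; rewrite di.
Qed.

(** A positive sequence which takes arbitrarily small values. *)
Lemma small_sequence :
  exists2 r : nat -> R, (forall k, 0 < r k) &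
    forall e, 0 < e -> exists k, r k < e.
Proof.
exists (fun k => k.+1%:R^-1) => [k|e e0]; first by rewrite invr_gt0 ltr0n.
have [k _ /(_ k (leqnn k)) ke] := near_infty_natSinv_lt (PosNum e0).
by exists k.
Qed.

(** A countable base of nonempty open sets. *)
Lemma countable_open_base : exists B : nat -> set X,
  [/\ forall j, open (B j), forall j, B j !=set0 &
      forall G x, open G -> G x -> exists2 j, B j x & B j `<=` G].
Proof.
have [d dP] := separable_sequence; have [r r0 rP] := small_sequence.
pose b (ik : nat * nat) := [set y | dist (d ik.1) y < r ik.2].
exists (fun j => if (unpickle j : option (nat * nat)) is Some ik
                 then b ik else setT); split.
- move=> j; case: unpickle => [ik|]; last exact: openT.
  exact: open_mdist_lt.
- move=> j; case: unpickle => [ik|]; last by exists point.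
  by exists (d ik.1); rewrite /b /= distxx.
- move=> G x oG Gx; have [e e0 eG] := open_mdist_ex oG Gx.
  have [|k ke] := rP (e / 2); first lra.
  have [i xi] := dP x _ (r0 k).
  exists (pickle (i, k)); rewrite pickleK /b /= 1?distC//.
  move=> y /= iy; apply: eG.
  by apply: (le_lt_trans (dist_triangle x (d i) y)); lra.
Qed.

End countable_base.

Section finite_orbits.
Variables (R : realType) (X : completeMetricType R) (f : X -> X).
Variable Q : set (compacts X).

(** All the partial orbits of [A] belong to the family [Q]. *)
Definition orbits_in (A : set X) :=
  forall N, in_family Q (orbit_upto f N A).

(** The condition through which the six statements are compared: in any finite
    list of nonempty open sets one can pick points that form a set with all
    partial orbits in [Q]. *)
Definition finite_orbits_dense := forall n (U : 'I_n.+1 -> set X),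
  (forall i, open (U i) /\ U i !=set0) ->
  exists2 x : 'I_n.+1 -> X, (forall i, U i (x i)) & orbits_in (range x).

End finite_orbits.

Section general_position.
Variables (R : realType) (X : completeMetricType R) (f : X -> X).
Hypotheses (X_separable : separable X) (f_continuous : continuous f).
Variable Q : set (compacts X).
Hypotheses (Q_Gdelta : Gdelta Q) (Q_hereditary : hereditary Q).

(** Every nonempty subset of a finite member of [Q] lies in the open set [F].
    As there are finitely many of them, a compact set contained in a small
    enough neighbourhood of the finite set, being close to one of its subsets,
    lies in [F] too. *)
Lemma finite_member_nbhs (I : finType) (y : I -> X) (F : set (compacts X)) :
  in_family Q (range y) -> open F -> Q `<=` F ->
  exists2 e : R, 0 < e & forall B : compacts X,
    (forall b, (B : set X) b -> exists i, dist (y i) b < e) -> F B.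
Proof.
move=> [K QK Ky] oF QF.
pose P (J : {set I}) (e : R) := forall B : compacts X,
  (forall b, (B : set X) b -> exists2 i, i \in J & dist (y i) b < e) ->
  (forall i, i \in J -> exists2 b, (B : set X) b & dist (y i) b < e) -> F B.
have [|J _|e e0 eP] := @finite_threshold R {set I} (enum [set: {set I}]) P.
- move=> J e e' Pe e'0 e'e B h1 h2; apply: Pe.
    by move=> b /h1[i Ji ib]; exists i => //; exact: lt_le_trans e'e.
  by move=> i /h2[b Bb ib]; exists b => //; exact: lt_le_trans e'e.
- have [->|[i0 i0J]] := set_0Vmem J.
    exists 1 => // B h1 _; have [b Bb] := carrier_nonempty B.
    by have [i] := h1 _ Bb; rewrite inE.
  pose yJ := y @` [set i | i \in J].
  have cyJ : compact yJ.
    by apply: finite_compact; exact/finite_image/finite_finset.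
  have nyJ : yJ !=set0 by exists (y i0), i0.
  have : F (Compacts cyJ nyJ).
    apply/QF/(Q_hereditary QK) => _ [i _ <-].
    by rewrite Ky; exists i.
  move=> /(open_mdist_ex oF)[e e0 eF]; exists (e / 2); first lra.
  move=> B h1 h2; apply: eF; apply: (@le_lt_trans _ _ (e / 2)); last lra.
  apply: hausdorff_le => /=.
    move=> _ [i iJ <-]; have [b Bb ib] := h2 i iJ.
    by exists b => //; exact: ltW.
  move=> b /h1[i iJ ib]; exists (y i); first by exists i.
  by rewrite distC ltW.
- exists e => // B Be.
  (* [B] is close to the set of the points of [range y] that are close to it *)
  pose J := [set i | `[< exists2 b, (B : set X) b & dist (y i) b < e >]]%SET.
  apply: (eP J); first by rewrite mem_enum inE.
    move=> b Bb; have [i ib] := Be b Bb; exists i => //.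
    by rewrite inE; apply/asboolP; exists b.
  by move=> i; rewrite inE => /asboolP.
Qed.

Hypothesis Q_dense : finite_orbits_dense f Q.

(** An open set that meets prescribed open sets and controls the partial orbits
    of its compact subsets: it consists of the points whose first [k] iterates
    stay close to the partial orbit of a well-chosen finite set. *)
Lemma orbit_controlled_open (F : nat -> set (compacts X)) k
    (g : 'I_k.+1 -> set X) :
  (forall j, open (F j)) -> (forall j, Q `<=` F j) ->
  (forall i, open (g i) /\ g i !=set0) ->
  exists V : set X, [/\ open V, forall i, g i `&` V !=set0 &
    forall B : compacts X, (B : set X) `<=` V -> forall N j,
      (N <= k)%N -> (j <= k)%N -> F j (orbit_compacts f_continuous N B)].
Proof.
move=> oF QF g_ok; have [x gx Qx] := Q_dense g_ok.
pose y (ti : 'I_k.+1 * 'I_k.+1) := iter ti.2 f (x ti.1).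
have Qy : in_family Q (range y).
  suff -> : range y = orbit_upto f k (range x) by [].
  apply/seteqP; split=> [_ [[t i] _ <-]|_ [i /= ik [_ [t _ <-] <-]]].
    by exists (i : nat); [exact: ltn_ord|exists (x t) => //; exists t].
  by exists (t, Ordinal ik).
have [e e0 eP] : exists2 e : R, 0 < e & forall j, j \in iota 0 k.+1 ->
    forall B : compacts X,
    (forall b, (B : set X) b -> exists i, dist (y i) b < e) -> F j B.
  apply: finite_threshold => [j e e' he e'0 e'e B Be'|j _].
    by apply: he => b /Be'[i ib]; exists i; exact: lt_le_trans e'e.
  exact: finite_member_nbhs.
exists (\bigcap_(i < k.+1) iter i f @^-1`
          [set z | exists t, dist (y t) z < e]); split.
- rewrite bigcap_mkord; apply: big_ind; [exact: openT|exact: openI|].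
  move=> i _; apply: open_comp => [z _|]; first exact: iter_continuous.
  apply: mdist_open => z [t tz]; exists (e - dist (y t) z); first lra.
  by move=> z' zz'; exists t; have := dist_triangle (y t) z z'; lra.
- move=> t; exists (x t); split=> // i /= ik.
  by exists (t, Ordinal ik); rewrite /y /= distxx.
- move=> B BV N j Nk jk; apply: eP; first by rewrite mem_iota.
  move=> _ [i /= iN [b Bb <-]].
  by apply: (BV b Bb i) => /=; exact: leq_trans iN _.
Qed.

(** Open sets [V k] such that a compact set included in infinitely many of them
    has its partial orbits in [Q], and such that every nonempty open set meets
    all the finite intersections of consecutive [V k] that start far enough. *)
Lemma general_position : exists V : nat -> set X,
  [/\ forall k, open (V k),
      forall G, open G -> G !=set0 -> exists n, forall m, exists2 x, G x &
        forall k, (n <= k < m)%N -> V k x &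
      forall B : set X, compact B -> B !=set0 ->
        (forall n, exists2 k, (n <= k)%N & B `<=` V k) -> orbits_in f Q B].
Proof.
have [F oF QF] := Q_Gdelta.
have QsubF j : Q `<=` F j by move=> K; rewrite QF => /(_ j I).
have [B [oB B0 Bbase]] := countable_open_base X_separable.
pose good k V := open V /\
  forall K : compacts X, (K : set X) `<=` V -> forall N j,
      (N <= k)%N -> (j <= k)%N -> F j (orbit_compacts f_continuous N K).
(* [g j] is what remains of [B j] after intersecting it with the open sets
   chosen at the stages [j, j + 1, ...]. *)
pose Inv (g : nat -> set X) := forall j, open (g j) /\ g j !=set0.
pose step k (g g' : nat -> set X) := exists V, good k V /\
  forall j, g' j = if (j <= k)%N then g j `&` V else g j.
have [|k g gI|u [u0 uP]] := @dependent_choice_inv _ Inv step B.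
- by move=> j; split.
- have [i|V [oV gV VP]] := @orbit_controlled_open F k (g \o val) oF QsubF.
    exact: gI.
  exists (fun j => if (j <= k)%N then g j `&` V else g j).
  split; last by exists V.
  move=> j; case: ifPn => [jk|_]; last exact: gI.
  split; first by apply: openI => //; case: (gI j).
  exact: (gV (Ordinal (jk : (j < k.+1)%N))).
have [V VP] := choice (fun k => (uP k).2).
have u_sub j m : u m j `<=` B j `&` [set x | forall k, (j <= k < m)%N -> V k x].
  elim: m => [|m IH].
    by rewrite u0 => x Bx; split=> // k; rewrite ltn0 andbF.
  have [_ ->] := VP m; case: ifPn => [jm x [/IH[Bx h] Vx]|jm x /IH[Bx h]].
    split=> // k /andP[jk]; rewrite ltnS leq_eqVlt => /predU1P[->//|km].
    by apply: h; rewrite jk.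
  split=> // k /andP[jk km]; exfalso; move: jm => /negP; apply.
  exact: leq_trans jk (km : (k <= m)%N).
exists V; split.
- by move=> k; have [[]] := VP k.
- move=> G oG [x Gx]; have [j Bjx BjG] := Bbase G x oG Gx.
  exists j => m; have [uI _] := uP m; have [_ [y uy]] := uI j.
  by have [/BjG Gy Vy] := u_sub _ _ _ uy; exists y.
- move=> K cK nK KV N; pose C := Compacts cK nK.
  exists (orbit_compacts f_continuous N C) => //.
  rewrite QF => j _; have [k Nk KVk] := KV (maxn N j).
  have [[_ +] _] := VP k; apply => //.
    exact: leq_trans (leq_maxl _ _) Nk.
  exact: leq_trans (leq_maxr _ _) Nk.
Qed.

End general_position.

(** * A nowhere meager dependent set *)

Section nested_balls.
Variables (R : realType) (X : completeMetricType R).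

Lemma nested_balls (c : nat -> X) (r : nat -> R) :
  (forall e, 0 < e -> exists n, r n < e) ->
  (forall n y, dist (c n.+1) y <= r n.+1 -> dist (c n) y <= r n) ->
  (forall n, 0 <= r n) ->
  exists x, forall n, dist (c n) x <= r n.
Proof.
move=> r_small nested r0.
have nestedW n k y : dist (c (n + k)%N) y <= r (n + k)%N -> dist (c n) y <= r n.
  by elim: k => [|k IH]; rewrite ?addn0// addnS => /nested/IH.
have near_c n : \forall k \near \oo, dist (c n) (c k) <= r n.
  exists n => // k /= nk; apply: (nestedW n (k - n)%N).
  by rewrite subnKC// distxx.
have /cauchy_cvg /cvg_ex[x cx] : cauchy (c @ \oo).
  apply: cauchy_exP => e e0; have [n rn] := r_small e e0.
  exists (c n); rewrite ballEmdist; apply: filterS (near_c n) => k /= ck.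
  exact: le_lt_trans ck rn.
exists x => n.
have := @closed_cvg _ _ (c @ \oo) _ id [set y | dist (c n) y <= r n].
apply; [exact: closed_mdist_le|exact: near_c|exact: cx].
Qed.

(** Inside a nonempty open set there are small closed balls which avoid a given
    nowhere dense set. *)
Lemma ball_avoiding (G F : set X) (e : R) :
  open G -> G !=set0 -> nowhere_dense F -> 0 < e ->
  exists c : X, exists2 r : R, 0 < r < e &
    forall y, dist c y <= r -> G y /\ ~ F y.
Proof.
move=> oG [x Gx] F0 e0.
have [c [Gc Fc]] : exists c, G c /\ ~ closure F c.
  apply: contrapT => /forallNP h.
  have : interior (closure F) x.
    rewrite /interior; apply: (@filterS _ _ _ G); last exact: open_nbhs_nbhs.
    by move=> y Gy; apply: contrapT => Fy; exact: (h y).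
  by rewrite F0.
have oGF : open (G `&` ~` closure F).
  by apply: openI => //; rewrite openC; exact: closed_closure.
have [d d0 dP] := open_mdist_ex oGF (conj Gc Fc).
exists c, (Num.min (d / 2) (e / 2)).
  by rewrite lt_min gt_min; apply/andP; split; [|apply/orP; right]; lra.
move=> y; rewrite le_min => /andP[cy _].
have [|Gy Fy] := dP y; first by apply: (le_lt_trans cy); lra.
by split=> // /subset_closure.
Qed.

End nested_balls.

Section nowhere_meager_set.
Variables (R : realType) (X : completeMetricType R).
Variable V : nat -> set X.
Hypothesis V_open : forall k, open (V k).
Hypothesis V_meets : forall G, open G -> G !=set0 -> exists n, forall m,
  exists2 x, G x & forall k, (n <= k < m)%N -> V k x.

(** Two interleaved sequences of balls produce two points of [W] outside the
    sets [F n], such that for all large [k] at least one of the two points lies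
    in [V k]. The ultrafilter then contains one of the two sets of indices. *)
Lemma ultra_limit_nowhere_meager (U : set_system nat) :
  UltraFilter U -> \oo `<=` U ->
  forall W (F : nat -> set X), open W -> W !=set0 ->
    (forall n, nowhere_dense (F n)) ->
  exists x, [/\ W x, U [set k | V k x] & forall n, ~ F n x].
Proof.
move=> UU ooU W F oW [w Ww] F_nd.
have [rad rad0 radP] := small_sequence R.
pose bl (g : X * R) := [set y | dist g.1 y < g.2].
pose ok n G := forall m, exists2 x, G x & forall k, (n <= k < m)%N -> V k x.
have ok_le n n' G : (n <= n')%N -> ok n G -> ok n' G.
  move=> nn' okG m; have [x Gx Vx] := okG m; exists x => // k /andP[n'k km].
  by apply: Vx; rewrite km (leq_trans nn').
(* A state [((a, b), (g, h))] consists of an interval of indices [a <= k < b], a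
   ball [g] to be shrunk now into all the [V k] with [k] in this interval, and a
   ball [h] waiting for the next interval, which starts at [b]. *)
pose Inv (s : (nat * nat) * ((X * R) * (X * R))) :=
  [/\ (s.1.1 < s.1.2)%N, 0 < s.2.1.2, 0 < s.2.2.2,
      ok s.1.1 (bl s.2.1) & ok s.1.2 (bl s.2.2)].
(* Each [F n] is avoided at the two stages [t] with [t./2 = n], that is, once
   for each of the two sequences of balls. *)
pose step t (s s' : (nat * nat) * ((X * R) * (X * R))) :=
  [/\ s'.1.1 = s.1.2, s'.2.1 = s.2.2, s'.2.2.2 < rad t./2 &
    forall y, dist s'.2.2.1 y <= s'.2.2.2 ->
      [/\ bl s.2.1 y, forall k, (s.1.1 <= k < s.1.2)%N -> V k y & ~ F t./2 y]].
have [e e0 eW] := open_mdist_ex oW Ww.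
have bl_open g : open (bl g) by exact: open_mdist_lt.
have bl_nonempty (g : X * R) : 0 < g.2 -> bl g !=set0.
  by move=> g0; exists g.1; rewrite /bl /= distxx.
have [n0 n0P] := V_meets (bl_open (w, e)) (bl_nonempty (w, e) e0).
have [||u [u0 uP]] :=
    @dependent_choice_inv _ Inv step ((n0, n0.+1), ((w, e), (w, e))).
- by split=> //=; apply: ok_le n0P.
- move=> t [[a b] [g h]] [/= ab g0 h0 ag bh].
  pose G := bl g `&` \bigcap_(k < b) [set x | (a <= k)%N -> V k x].
  have oG : open G.
    apply: openI => //; rewrite bigcap_mkord.
    apply: big_ind => [||k _]; [exact: openT|exact: openI|].
    have [->//|->] : [set x | (a <= k)%N -> V k x] = V k \/
        [set x | (a <= k)%N -> V k x] = setT; last exact: openT.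
    have [ak|/negP ak] := boolP (a <= k)%N.
      by left; apply/seteqP; split=> x /=; [exact|].
    by right; apply/seteqP; split=> x //=.
  have nG : G !=set0.
    have [x gx Vx] := ag b; exists x; split=> // k /= kb ak.
    by apply: Vx; rewrite ak.
  have [c [r /andP[r0 rt] cP]] := ball_avoiding oG nG (F_nd t./2) (rad0 t./2).
  have [n nP] := V_meets (bl_open (c, r)) (bl_nonempty (c, r) r0).
  exists ((b, maxn b.+1 n), (h, (c, r))); split; split=> //=.
  + by rewrite leq_maxl.
  + by apply: ok_le nP; exact: leq_maxr.
  + by move=> y /cP[[gy Vy] Fy]; split=> // k /andP[ak kb]; exact: Vy.
pose a t := (u t).1.1; pose g t := (u t).2.1.
have aS t : a t.+1 = (u t).1.2 by have [_ []] := uP t.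
have a_lt t : (a t < a t.+1)%N by rewrite aS; have [[]] := uP t.
have gS t : g t.+1 = (u t).2.2 by have [_ []] := uP t.
have g_pos t : 0 < (g t).2 by have [[]] := uP t.
have g_rad t : (g t.+2).2 < rad t./2 by rewrite gS; have [_ []] := uP t.
have g_in t y : dist (g t.+2).1 y <= (g t.+2).2 ->
    [/\ bl (g t) y, forall k, (a t <= k < a t.+1)%N -> V k y & ~ F t./2 y].
  by rewrite gS aS; have [_ [_ _ _]] := uP t; exact.
(* The balls [g (p + t.*2)] are the successive balls of one of the sequences,
   which is selected by the parity [p]. *)
have point (p : bool) : exists x, forall t,
    dist (g (p + t.*2)%N).1 x <= (g (p + t.*2)%N).2.
  apply: nested_balls => [d /radP[k kd]|t y|t]; last exact: ltW.
  + exists k.+1; rewrite doubleS !addnS; apply: lt_trans kd.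
    by have := g_rad (p + k.*2)%N; rewrite half_bit_double.
  + by rewrite doubleS !addnS => /g_in[/ltW].
have point_in (p : bool) x :
    (forall t, dist (g (p + t.*2)%N).1 x <= (g (p + t.*2)%N).2) ->
    W x /\ forall t, [/\ bl (g (p + t.*2)%N) x, ~ F t x &
      forall k, (a (p + t.*2) <= k < a (p + t.*2).+1)%N -> V k x].
  move=> xP.
  have gx t : [/\ bl (g (p + t.*2)%N) x, ~ F t x &
      forall k, (a (p + t.*2) <= k < a (p + t.*2).+1)%N -> V k x].
    have := xP t.+1; rewrite doubleS !addnS => /g_in[].
    by rewrite half_bit_double.
  split=> //; have [+ _ _] := gx 0%N; rewrite /g.
  suff -> : (u (p + 0.*2)%N).2.1 = (w, e) by exact: eW.
  by case: p {xP gx}; rewrite ?addn0 -?/(g _) ?gS /g u0.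
have [x xP] := point true; have [y yP] := point false.
have [Wx {}xP] := point_in _ _ xP; have [Wy {}yP] := point_in _ _ yP.
have [Ux|Ux] := in_ultra_setVsetC [set k | V k x] UU.
  by exists x; split=> // n; have [] := xP n.
exists y; split=> //; last by move=> n; have [] := yP n.
have Ua : U [set k | (a 0 <= k)%N] by apply: ooU; exists (a 0%N).
apply: filterS (filterI Ux Ua) => k [/= nVx ak].
(* For [k] in an interval of odd rank, [x] lies in [V k], and for [k] in an
   interval of even rank, [y] does. *)
have [t tk] : exists t, (a t <= k < a t.+1)%N.
  have a_ge t : (t <= a t)%N.
    by elim: t => // t IH; exact: leq_ltn_trans (a_lt t).
  have [t at_k t_max] := @ex_maxnP (fun t => a t <= k)%N k
    (ex_intro _ 0%N ak) (fun t h => leq_trans (a_ge t) h).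
  exists t; rewrite at_k ltnNge; apply/negP => /t_max; by rewrite ltnn.
move: tk; rewrite -[t]odd_double_half; case: (odd t) => tk.
  by have [_ _ /(_ k tk)] := xP t./2.
by have [_ _ /(_ k tk)] := yP t./2.
Qed.

End nowhere_meager_set.

(** * Cantor subsets of metric spaces *)

Section homeomorphic_equivalence.
Implicit Types T U W : topologicalType.

Lemma homeomorphic_sym T U : homeomorphic T U -> homeomorphic U T.
Proof. by move=> [g [h [cg ch gK hK]]]; exists h, g. Qed.

Lemma homeomorphic_trans T U W :
  homeomorphic T U -> homeomorphic U W -> homeomorphic T W.
Proof.
move=> [g [h [cg ch gK hK]]] [g' [h' [cg' ch' gK' hK']]].
exists (g' \o g), (h \o h'); split.
- by move=> x; apply: continuous_comp; [exact: cg|exact: cg'].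
- by move=> x; apply: continuous_comp; [exact: ch'|exact: ch].
- exact: can_comp gK' gK.
- exact: can_comp hK hK'.
Qed.

End homeomorphic_equivalence.

(** The intrinsic description of the Cantor sets among the subsets of a space:
    nonempty, compact, without isolated points, and such that any two points
    can be separated by a partition into two closed pieces. *)
Definition cantor_subset (X : topologicalType) (A : set X) :=
  [/\ compact A, A !=set0,
      forall x U, A x -> nbhs x U -> exists y, [/\ A y, U y & y != x] &
      forall x y, A x -> A y -> x != y -> exists C1 C2 : set X,
        [/\ closed C1, closed C2, A `<=` C1 `|` C2,
            forall z, A z -> C1 z -> C2 z -> False & C1 x /\ C2 y]].

Section brouwer.
Variables (R : realType) (X : pseudoMetricType R) (A : set X) (a0 : A).
Hypothesis X_hausdorff : hausdorff_space X.

#[local] HB.instance Definition _ := isPointed.Build A a0.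

Lemma set_type_compact : compact A -> compact [set: A].
Proof.
move=> cA F FF _.
have GA : (set_val @ F) A.
  suff : F (set_val @^-1` A) by [].
  apply: filterS filterT => x _; rewrite /preimage /= set_valE.
  exact: set_valP.
have [x [Ax clx]] := cA (set_val @ F) _ GA.
exists (exist _ x (mem_set Ax)); split=> // S N FS [W [[W' oW' WW'] Wx] WN].
have [||_ [[s Ss <-] W's]] := clx (set_val @` S) W'.
- suff : F (set_val @^-1` (set_val @` S)) by [].
  by apply: filterS FS => s Ss; exists s.
- apply: open_nbhs_nbhs; split=> //.
  by move: Wx; rewrite -WW' /= set_valE.
- by exists s; split=> //; apply: WN; rewrite -WW'.
Qed.

Lemma set_type_hausdorff : hausdorff_space A.
Proof.
move=> x y clxy; apply/val_inj/X_hausdorff => N M Nx My.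
have nbhs_pre (z : A) (S : set X) : nbhs (val z) S -> nbhs z (set_val @^-1` S).
  move=> Sz; apply: (@initial_continuous A X set_val z).
  by rewrite set_valE.
have [z [Nz Mz]] := clxy _ _ (nbhs_pre _ _ Nx) (nbhs_pre _ _ My).
by exists (set_val z).
Qed.

Lemma set_type_closed (C : set X) :
  closed C -> closed (set_val @^-1` C : set A).
Proof.
move=> cC; apply: closed_comp => // z _.
exact: (@initial_continuous A X set_val z).
Qed.

Lemma cantor_subset_cantor_like : cantor_subset A -> cantor_like A.
Proof.
move=> [cA _ A_perf A_zero]; split.
- apply/perfectTP => x [W oW Wx].
  have [||y [Ay Wy /eqP yx]] := A_perf (val x) W.
  + exact: set_valP.
  + apply: open_nbhs_nbhs; split=> //.
    by have : [set x] x by []; rewrite -Wx /= set_valE.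
  + apply: yx; have : [set x] (exist _ y (mem_set Ay)).
      by rewrite -Wx /= set_valE.
    by move=> <-.
- exact: set_type_compact.
- exact: set_type_hausdorff.
- move=> x y xy.
  have [||//|C1 [C2 [cC1 cC2 AC C12 [C1x C2y]]]] := A_zero (val x) (val y).
  + exact: set_valP.
  + exact: set_valP.
  + exists (set_val @^-1` C1); rewrite /= set_valE; split=> //.
      split; last by rewrite -set_valE; exact: set_type_closed.
      rewrite -[X in open X]setCK openC.
      suff -> : ~` (val @^-1` C1) = val @^-1` C2 :> set A.
        by rewrite -set_valE; exact: set_type_closed.
      apply/seteqP; split=> z /= Cz.
        by have [/Cz|] := AC _ (set_valP z).
      by move=> C1z; exact: (C12 _ (set_valP z) C1z Cz).
    by move=> C1y; exact: (C12 _ (set_valP y) C1y C2y).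
Qed.

Lemma cantor_subset_cantor_space :
  cantor_subset A -> homeomorphic cantor_space A.
Proof.
move=> /cantor_subset_cantor_like /homeomorphism_cantor_like[F [cF clF]].
have [h FK hK] : bijective F by rewrite -setTT_bijective; exact: bij.
exists F, h; split=> //; apply/continuous_closedP => C cC.
suff -> : h @^-1` C = F @` C by exact: clF.
apply/seteqP; split=> [z Cz|_ [c Cc <-]]; first by exists (h z).
by rewrite /preimage /= FK.
Qed.

End brouwer.

(** Brouwer's characterization for subsets of metrizable spaces. *)
Lemma cantor_subset_homeomorphic (R : realType) (X : pseudoMetricType R)
    (A : set X) : hausdorff_space X -> cantor_subset A ->
  homeomorphic cantor_space A.
Proof.
move=> hX cA; have [_ [a Aa] _ _] := cA.
exact: (cantor_subset_cantor_space (exist _ a (mem_set Aa)) hX).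
Qed.

Section middle_third_cantor.
Variable R : realType.
Local Notation C := (middle_third R).
Local Notation step := (@middle_third_step R).

Lemma step_itv n x : step n x -> 0 <= x <= 1.
Proof.
elim: n x => [|n IH] x //= [[y /IH/andP[y0 y1] <-]|[y /IH/andP[y0 y1] <-]].
  by apply/andP; split; lra.
by apply/andP; split; lra.
Qed.

Lemma stepS_left n x : step n.+1 x -> x < 2 / 3 -> step n (3 * x).
Proof.
move=> [[y Ty <-] _|[y /step_itv/andP[y0 y1] <-]]; last lra.
by rewrite (_ : 3 * (y / 3) = y)//; lra.
Qed.

Lemma stepS_right n x : step n.+1 x -> 1 / 3 < x -> step n (3 * x - 2).
Proof.
move=> [[y /step_itv/andP[y0 y1] <-]|[y Ty <-] _]; first lra.
by rewrite (_ : 3 * ((2 + y) / 3) - 2 = y)//; lra.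
Qed.

Lemma stepS_gap n x : step n.+1 x -> x <= 1 / 3 \/ 2 / 3 <= x.
Proof.
by move=> [[y /step_itv/andP[y0 y1] <-]|[y /step_itv/andP[y0 y1] <-]];
  [left|right]; lra.
Qed.

Lemma middle_third_left x : C x -> C (x / 3).
Proof.
move=> Cx [|n] _; last by left; exists x => //; exact: Cx.
by have /andP[x0 x1] := step_itv (Cx 0%N I); apply/andP; split; lra.
Qed.

Lemma middle_third_right x : C x -> C ((2 + x) / 3).
Proof.
move=> Cx [|n] _; last by right; exists x => //; exact: Cx.
by have /andP[x0 x1] := step_itv (Cx 0%N I); apply/andP; split; lra.
Qed.

Lemma middle_third_split x : C x ->
  (exists2 y, C y & x = y / 3) \/ (exists2 y, C y & x = (2 + y) / 3).
Proof.
move=> Cx; have [x_left|x_right] := stepS_gap (Cx 1%N I).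
  left; exists (3 * x); last lra.
  by move=> n _; apply: stepS_left; [exact: Cx|lra].
right; exists (3 * x - 2); last lra.
by move=> n _; apply: stepS_right; [exact: Cx|lra].
Qed.

Lemma pow3_gt0 n : 0 < (3%:R : R)^-1 ^+ n.
Proof. by rewrite exprn_gt0// invr_gt0. Qed.

Lemma small_pow3 (e : R) : 0 < e -> exists n, (3%:R : R)^-1 ^+ n < e.
Proof.
move=> e0.
have := @cvg_expr R 3%:R^-1; rewrite gtr0_norm// => /(_ _)/cvgrPdist_lt.
rewrite invf_lt1// ltr1n => /(_ isT e e0)[n _ /(_ n (leqnn n))] /=.
by rewrite sub0r normrN gtr0_norm ?pow3_gt0//; exists n.
Qed.

(** A point of the middle-third set has another one within [3 ^ - n]; by
    self-similarity, this reduces to the case [n = 0]. *)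
Lemma middle_third_near n x : C x ->
  exists y, [/\ C y, y != x & `|x - y| <= 3%:R^-1 ^+ n].
Proof.
have C01 : C 0 /\ C 1.
  split=> m _; elim: m => [|m IH] /=.
  - by rewrite lexx ler01.
  - by left; exists 0 => //; rewrite mul0r.
  - by rewrite lexx ler01.
  - by right; exists 1 => //; lra.
elim: n x => [|n IH] x Cx.
  have /andP[x0 x1] := step_itv (Cx 0%N I).
  have [->|x_neq0] := eqVneq x 0.
    exists 1; split; [by case: C01|by rewrite oner_neq0|].
    by rewrite expr0 ler_norml; lra.
  exists 0; split; [by case: C01|by rewrite eq_sym|].
  by rewrite expr0 ler_norml; lra.
have [[y Cy ->]|[y Cy ->]] := middle_third_split Cx.
  have [z [Cz zy yz]] := IH y Cy; exists (z / 3); split.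
  - exact: middle_third_left.
  - by apply: contra_neq zy; lra.
  - by move: yz; rewrite exprS !ler_norml => /andP[]; lra.
have [z [Cz zy yz]] := IH y Cy; exists ((2 + z) / 3); split.
- exact: middle_third_right.
- by apply: contra_neq zy; lra.
- by move: yz; rewrite exprS !ler_norml => /andP[]; lra.
Qed.

(** Two points of the [n]-th step at distance more than [3 ^ - n] are separated
    by a point outside that step. *)
Lemma middle_third_gap n x y : step n x -> step n y ->
  3%:R^-1 ^+ n < y - x -> exists2 z, x < z < y & ~ step n z.
Proof.
elim: n x y => [|n IH] x y Tx Ty.
  rewrite expr0 => xy.
  have /andP[x0 x1] := step_itv Tx; have /andP[y0 y1] := step_itv Ty; lra.
have pow0 := pow3_gt0 n; rewrite exprS => xy.
have [xl|xr] := stepS_gap Tx; have [yl|yr] := stepS_gap Ty.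
- have [|||z /andP[xz zy] Tz] := IH (3 * x) (3 * y).
  + by apply: stepS_left => //; lra.
  + by apply: stepS_left => //; lra.
  + lra.
  exists (z / 3); first by apply/andP; split; lra.
  move=> /stepS_left; rewrite (_ : 3 * (z / 3) = z); last lra.
  by move=> h; apply/Tz/h; lra.
- exists (1 / 2); first by apply/andP; split; lra.
  by move=> /stepS_gap[]; lra.
- by exfalso; lra.
- have [|||z /andP[xz zy] Tz] := IH (3 * x - 2) (3 * y - 2).
  + by apply: stepS_right => //; lra.
  + by apply: stepS_right => //; lra.
  + lra.
  exists ((2 + z) / 3); first by apply/andP; split; lra.
  move=> /stepS_right; rewrite (_ : 3 * ((2 + z) / 3) - 2 = z); last lra.
  by move=> h; apply/Tz/h; lra.
Qed.

Lemma step_closed n : closed (step n).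
Proof.
have cont (a b : R) : continuous (fun x : R => a * x - b).
  move=> x; apply: cvgB; last exact: cvg_cst.
  by apply: cvgM; [exact: cvg_cst|exact: cvg_id].
elim: n => [|n IH] /=.
  rewrite (_ : mkset _ = `[0, 1]%classic); first exact: itv_closed.
  by apply/seteqP; split=> x /=; rewrite in_itv.
apply: closedU.
  rewrite (_ : image _ _ = (fun x : R => 3 * x - 0) @^-1` step n).
    by apply: closed_comp => // x _; exact: cont.
  apply/seteqP; split=> [_ [y Ty <-]|x Tx] /=.
    by rewrite (_ : 3 * (y / 3) - 0 = y)//; lra.
  by exists (3 * x - 0) => //; lra.
rewrite (_ : image _ _ = (fun x : R => 3 * x - 2) @^-1` step n).
  by apply: closed_comp => // x _; exact: cont.
apply/seteqP; split=> [_ [y Ty <-]|x Tx] /=.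
  by rewrite (_ : 3 * ((2 + y) / 3) - 2 = y)//; lra.
by exists (3 * x - 2) => //; lra.
Qed.

Lemma middle_third_cantor_subset : cantor_subset C.
Proof.
have cC : closed C by apply: closed_bigI => n _; exact: step_closed.
split.
- apply: (subclosed_compact cC (@segment_compact R 0 1)).
  by move=> x /(_ 0%N I) /=; rewrite in_itv.
- exists 0 => n _; elim: n => [|n IH] /=; first by rewrite lexx ler01.
  by left; exists 0 => //; rewrite mul0r.
- move=> x U Cx /nbhs_ballP[e /= e0 eU]; have [n ne] := small_pow3 e0.
  have [y [Cy yx xy]] := middle_third_near n Cx.
  exists y; split=> //; apply: eU.
  by rewrite -ball_normE /=; exact: le_lt_trans ne.
- suff sep x y : C x -> C y -> x < y -> exists z, [/\ x < z, z < y & ~ C z].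
    move=> x y Cx Cy; rewrite neq_lt => /orP[xy|yx].
      have [z [xz zy Cz]] := sep x y Cx Cy xy.
      exists [set t | t <= z], [set t | z <= t]; split.
      + exact: closed_le.
      + exact: closed_ge.
      + by move=> t _; have [tz|/ltW zt] := leP t z; [left|right].
      + move=> t Ct /= tz zt; apply: Cz; rewrite (_ : z = t)//.
        by apply/eqP; rewrite eq_le zt.
      + by split; exact: ltW.
    have [z [yz zx Cz]] := sep y x Cy Cx yx.
    exists [set t | z <= t], [set t | t <= z]; split.
    + exact: closed_ge.
    + exact: closed_le.
    + by move=> t _; have [tz|/ltW zt] := leP t z; [right|left].
    + move=> t Ct /= zt tz; apply: Cz; rewrite (_ : z = t)//.
      by apply/eqP; rewrite eq_le zt.
    + by split; exact: ltW.
  move=> Cx Cy xy; have [|n nxy] := @small_pow3 (y - x); first lra.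
  have [z /andP[xz zy] Tz] := middle_third_gap (Cx n I) (Cy n I) nxy.
  by exists z; split=> // /(_ n I).
Qed.

End middle_third_cantor.

(** * Cantor sets in the upper limit of the open sets *)

(** An ultrafilter that contains a finite union contains one of its terms. *)
Lemma ultra_finite_cover (T : Type) (I : eqType) (U : set_system T) (s : seq I)
    (C : I -> set T) : UltraFilter U -> U (\bigcup_(i in [set` s]) C i) ->
  exists2 i, i \in s & U (C i).
Proof.
move=> UU; elim: s => [|i s IH].
  rewrite (_ : bigcup _ _ = set0); first by move=> /filter_not_empty.
  by apply/seteqP; split=> x // [].
move=> h.
have [UC|UC] := in_ultra_setVsetC (C i) UU.
  by exists i; rewrite ?mem_head.
have [|j js UCj] := IH; last by exists j => //; rewrite inE js orbT.
apply: filterS (filterI h UC) => x [[j /=]].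
by rewrite inE => /predU1P[-> //|js Cj _]; exists j.
Qed.

(** A scheme of closed balls: at level [l] the balls have radius [r l] and
    centres in the finite list [K l]; they are pairwise disjoint, each of them
    is included in a ball of the previous level, and each contains two balls of
    the next level. *)
Section scheme.
Variables (R : realType) (X : completeMetricType R).
Variables (K : nat -> seq X) (r : nat -> R).
Hypothesis r_gt0 : forall l, 0 < r l.
Hypothesis r_small : forall e, 0 < e -> exists l, r l < e.
Hypothesis K_neq0 : K 0%N != [::].
Hypothesis K_sep : forall l p q, p \in K l -> q \in K l -> p != q ->
  2 * r l < dist p q.
Hypothesis K_parent : forall l q, q \in K l.+1 ->
  exists2 p, p \in K l & dist p q + r l.+1 <= r l.
Hypothesis K_children : forall l p, p \in K l ->
  exists q1 q2, [/\ q1 \in K l.+1, q2 \in K l.+1, q1 != q2,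
    dist p q1 + r l.+1 <= r l & dist p q2 + r l.+1 <= r l].

(** The union of the closed balls of level [l]. *)
Definition scheme_level l :=
  \bigcup_(p in [set` K l]) [set y | dist p y <= r l].

(** The Cantor set defined by the scheme. *)
Definition scheme_limit := \bigcap_l scheme_level l.

Lemma scheme_levelS l : scheme_level l.+1 `<=` scheme_level l.
Proof.
move=> y [q /K_parent[p pK pq] /= qy]; exists p => //=.
by have := dist_triangle p q y; lra.
Qed.

Lemma scheme_level_le l m : (l <= m)%N -> scheme_level m `<=` scheme_level l.
Proof.
elim: m => [|m IH]; first by rewrite leqn0 => /eqP ->.
rewrite leq_eqVlt => /predU1P[->//|/IH].
by apply: subset_trans; exact: scheme_levelS.
Qed.

Lemma scheme_limit_closed : closed scheme_limit.
Proof.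
apply: closed_bigI => l _; rewrite /scheme_level bigcup_seq.
by apply: closed_bigsetU => p _; exact: closed_mdist_le.
Qed.

Lemma scheme_nonempty l : exists p, p \in K l.
Proof.
elim: l => [|l [p /K_children[q [_ [qK _ _ _ _]]]]]; last by exists q.
by case: (K 0%N) K_neq0 => // p s _; exists p; rewrite mem_head.
Qed.

Lemma scheme_radius_le l m : (l <= m)%N -> r m <= r l.
Proof.
move=> /subnKC <-; elim: (m - l)%N => [|n IH]; first by rewrite addn0.
rewrite addnS; apply: le_trans IH.
have [p /K_children[q [_ [_ _ _ + _]]]] := scheme_nonempty (l + n).
by have := dist_ge0 p q; lra.
Qed.

(** Each ball of the scheme contains a point of the limit. *)
Lemma scheme_limit_ball l p : p \in K l ->
  exists2 x, scheme_limit x & dist p x <= r l.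
Proof.
move=> pK.
have [||u [u0 uP]] := @dependent_choice_inv _ (fun s : nat * X => s.2 \in K s.1)
  (fun _ s s' => s'.1 = s.1.+1 /\ dist s.2 s'.2 + r s'.1 <= r s.1) (l, p).
- by [].
- move=> _ [m q] /= /K_children[q1 [_ [q1K _ _ qq1 _]]].
  by exists (m.+1, q1).
have u1 n : (u n).1 = (l + n)%N.
  elim: n => [|n IH]; first by rewrite u0 addn0.
  by have [_ [-> _]] := uP n; rewrite IH addnS.
have [|n y|n|x xP] := @nested_balls _ _ (fun n => (u n).2) (fun n => r (u n).1).
- move=> e /r_small[m me]; exists m; rewrite u1; apply: le_lt_trans me.
  exact/scheme_radius_le/leq_addl.
- have [_ [_ h]] := uP n; move: h => /= h uy.
  by have := dist_triangle (u n).2 (u n.+1).2 y; lra.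
- exact: ltW.
exists x; last by have := xP 0%N; rewrite u0.
move=> m _; apply: (@scheme_level_le m (l + m)); first exact: leq_addl.
rewrite -u1; have [um _] := uP m.
by exists (u m).2; last exact: xP.
Qed.

Lemma scheme_limit_compact : compact scheme_limit.
Proof.
rewrite compact_ultra => U UU UA.
have Uball l : exists2 p, p \in K l & U [set y | dist p y <= r l].
  apply: ultra_finite_cover; apply: filterS UA => x; exact.
have [x Ux] : exists x : X, U --> x.
  apply/cvg_ex/(@cauchy_cvg X U); apply: cauchy_exP => e /r_small[l le_].
  have [p _ Up] := Uball l.
  exists p; rewrite ballEmdist; apply: filterS Up => y /= py.
  exact: le_lt_trans le_.
exists x; split=> //.
have := @closed_cvg _ _ U _ id scheme_limit.
by apply; [exact: scheme_limit_closed|exact: UA|exact: Ux].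
Qed.

Lemma scheme_limit_cantor : cantor_subset scheme_limit.
Proof.
split.
- exact: scheme_limit_compact.
- have [p /scheme_limit_ball[x Ax _]] := scheme_nonempty 0; by exists x.
- move=> x U Ax /nbhs_mdist_ex[e e0 eU].
  have [|l le_] := @r_small (e / 2); first lra.
  have [p pK /= px] := Ax l I.
  have [q1 [q2 [q1K q2K q12 pq1 pq2]]] := K_children pK.
  have [a1 Aa1 qa1] := scheme_limit_ball q1K.
  have [a2 Aa2 qa2] := scheme_limit_ball q2K.
  have a12 : a1 != a2.
    apply/eqP => a12; have := K_sep q1K q2K q12.
    by have := dist_triangle q1 a1 q2; rewrite (distC a1) {2}a12; lra.
  have in_U q a : dist p q + r l.+1 <= r l -> dist q a <= r l.+1 -> U a.
    move=> pq qa; apply: eU; have := dist_triangle x p a.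
    by have := dist_triangle p q a; rewrite (distC x p); lra.
  have [a1x|a1x] := eqVneq a1 x; last by exists a1; split=> //; exact: in_U qa1.
  by exists a2; split; [|exact: in_U qa2|rewrite -a1x eq_sym].
- move=> x y Ax Ay xy.
  have [|l le_] := @r_small (dist x y / 2).
    by rewrite divr_gt0// dist_gt0.
  have [p pK /= px] := Ax l I.
  exists [set z | dist p z <= r l].
  exists (\bigcup_(q in [set` [seq q <- K l | q != p]])
            [set z | dist q z <= r l]).
  split.
  + exact: closed_mdist_le.
  + by rewrite bigcup_seq; apply: closed_bigsetU => q _; exact: closed_mdist_le.
  + move=> z /(_ l I)[q qK /= qz]; have [<-|qp] := eqVneq q p; first by left.
    by right; exists q => //=; rewrite mem_filter qp.
  + move=> z _ /= pz [q /=]; rewrite mem_filter => /andP[qp qK] qz.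
    have := K_sep qK pK qp; have := dist_triangle q z p.
    by rewrite (distC z p); lra.
  + split=> //; have [q qK /= qy] := Ay l I.
    have [qp|qp] := eqVneq q p; last by exists q => //=; rewrite mem_filter qp.
    exfalso; rewrite qp in qy; have := dist_triangle x p y.
    by rewrite (distC x p); lra.
Qed.

End scheme.

Section cantor_sequence.
Variables (R : realType) (X : completeMetricType R).
Hypothesis X_perfect : isolated [set: X] = set0.

Lemma perfect_two_points (G : set X) : open G -> G !=set0 ->
  exists x y, [/\ G x, G y & x != y].
Proof.
have /perfectTP_ex : perfect_set [set: X]; last exact.
by apply/perfectP; split; [exact: closedT|].
Qed.

(** Refinement of one level of a scheme inside an open set meeting its balls. *)
Lemma scheme_step (K : seq X) (r rho : R) (V : set X) :
  0 < rho -> open V ->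
  (forall p, p \in K -> [set y | dist p y < r] `&` V !=set0) ->
  exists (K' : seq X) (r' : R),
  [/\ 0 < r' < rho,
      forall p q, p \in K' -> q \in K' -> p != q -> 2 * r' < dist p q,
      forall q, q \in K' -> exists2 p, p \in K & dist p q + r' <= r,
      forall p, p \in K -> exists q1 q2, [/\ q1 \in K', q2 \in K', q1 != q2,
        dist p q1 + r' <= r & dist p q2 + r' <= r] &
      forall q y, q \in K' -> dist q y <= r' -> V y].
Proof.
move=> rho0 oV KV.
have /choice[c cP] : forall p, exists c : X * X, p \in K ->
    [/\ dist p c.1 < r, dist p c.2 < r, V c.1, V c.2 & c.1 != c.2].
  move=> p; have [pK|_] := boolP (p \in K); last by exists (p, p).
  have [|x [y [[px Vx] [py Vy] xy]]] := perfect_two_points _ (KV p pK).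
    by apply: openI => //; exact: open_mdist_lt.
  by exists (x, y).
pose K' := [seq (c p).1 | p <- K] ++ [seq (c p).2 | p <- K].
have K'P q : q \in K' -> exists2 p, p \in K & q = (c p).1 \/ q = (c p).2.
  by rewrite mem_cat => /orP[] /mapP[p pK ->]; exists p => //; [left|right].
have [e1 e10 e1P] : exists2 e : R, 0 < e & forall p, p \in K ->
    dist p (c p).1 + e <= r /\ dist p (c p).2 + e <= r.
  apply: finite_threshold => [p e e' [h1 h2] _ e'e|p pK]; first by split; lra.
  have [pc1 pc2 _ _ _] := cP p pK.
  exists (Num.min (r - dist p (c p).1) (r - dist p (c p).2)).
    by rewrite lt_min !subr_gt0 pc1.
  by split; rewrite -lerBrDl ge_min lexx ?orbT.
have [e2 e20 e2P] : exists2 e : R, 0 < e & forall q, q \in K' ->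
    forall y, dist q y <= e -> V y.
  apply: finite_threshold => [q e e' he _ e'e y qy|q /K'P[p pK qE]].
    by apply: he; exact: le_trans e'e.
  have [_ _ V1 V2 _] := cP p pK.
  have Vq : V q by case: qE => ->.
  have [e e0 eV] := open_mdist_ex oV Vq; exists (e / 2); first lra.
  by move=> y qy; apply: eV; lra.
have [e3 e30 e3P] : exists2 e : R, 0 < e & forall pq : X * X,
    pq \in [seq (p, q) | p <- K', q <- K'] ->
    pq.1 != pq.2 -> 2 * e < dist pq.1 pq.2.
  apply: finite_threshold => [pq e e' he _ e'e /he|[p q] _ /=]; first lra.
  have [<-|pq] := eqVneq p q; first by exists 1.
  have pq0 : 0 < dist p q by rewrite dist_gt0.
  by exists (dist p q / 4); [|move=> _]; lra.
exists K', (Num.min (rho / 2) (Num.min e1 (Num.min e2 e3))).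
set r' := Num.min _ _.
have [r'rho r'e1 r'e2 r'e3] : [/\ r' <= rho / 2, r' <= e1, r' <= e2 & r' <= e3].
  by rewrite /r'; split; rewrite !ge_min lexx ?orbT.
have r'0 : 0 < r' by rewrite /r' !lt_min e10 e20 e30 !andbT; lra.
split.
- by rewrite r'0; lra.
- move=> p q pK' qK' pq; have := e3P (p, q) _ pq => /= h.
  by apply: le_lt_trans (h _); [lra|apply/allpairsP; exists (p, q)].
- move=> q /K'P[p pK qE]; exists p => //.
  by have [h1 h2] := e1P p pK; case: qE => ->; lra.
- move=> p pK; have [h1 h2] := e1P p pK; have [_ _ _ _ c12] := cP p pK.
  exists (c p).1, (c p).2; split=> //; [| |lra|lra].
    by rewrite mem_cat; apply/orP; left; apply/mapP; exists p.
  by rewrite mem_cat; apply/orP; right; apply/mapP; exists p.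
- move=> q y qK' qy; apply: e2P qK' _ _; exact: le_trans r'e2.
Qed.

(** [A] and [B] are within Hausdorff distance [e] of each other; bare subsets
    are compared, so that [B] may be given by a finite list. *)
Definition sets_within (e : R) (A B : set X) :=
  (forall a, A a -> exists2 b, B b & dist b a <= e) /\
  (forall b, B b -> exists2 a, A a & dist b a <= e).

Variable V : nat -> set X.
Hypothesis V_open : forall k, open (V k).
Hypothesis V_meets : forall G, open G -> G !=set0 ->
  exists n, forall k, (n <= k)%N -> G `&` V k !=set0.

(** [E] is infinite: it contains arbitrarily large indices. *)
Definition infinite_indices (E : set nat) :=
  forall n, exists2 k, (n <= k)%N & E k.

(** Near any nonempty finite set there is a Cantor set included in [V k] for
    infinitely many [k] taken from a given infinite set of indices. *)
Lemma limsup_cantor (E : set nat) (K0 : seq X) (e : R) :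
  infinite_indices E -> K0 != [::] -> 0 < e ->
  exists (A : set X) (E' : set nat),
    [/\ cantor_subset A, sets_within e A [set` K0], infinite_indices E',
        E' `<=` E & forall k, E' k -> A `<=` V k].
Proof.
move=> E_inf K00 e0; have [rad rad0 radP] := small_sequence R.
have [r0 r00 r0P] : exists2 r : R, 0 < r & forall pq : X * X,
    pq \in [seq (p, q) | p <- K0, q <- K0] ->
    r <= e /\ (pq.1 != pq.2 -> 2 * r < dist pq.1 pq.2).
  apply: finite_threshold => [pq d d' [de hd] _ d'd|[p q] _ /=].
    by split=> [|/hd]; lra.
  have [<-|pq] := eqVneq p q; first by exists e.
  have pq0 : 0 < dist p q by rewrite dist_gt0.
  exists (Num.min e (dist p q / 4)); first by rewrite lt_min e0; lra.
  split=> [|_]; first by rewrite ge_min lexx.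
  have : Num.min e (dist p q / 4) <= dist p q / 4 by rewrite ge_min lexx orbT.
  lra.
(* A state consists of the centres and the radius of one level of the scheme,
   and of the index of the open set [V k] which contains that level. *)
pose Inv (s : (seq X * R) * nat) := 0 < s.1.2.
pose step l (s s' : (seq X * R) * nat) :=
  [/\ (s.2 < s'.2)%N /\ E s'.2, s'.1.2 < rad l,
      (forall p q, p \in s'.1.1 -> q \in s'.1.1 -> p != q ->
         2 * s'.1.2 < dist p q) /\
      (forall q, q \in s'.1.1 ->
         exists2 p, p \in s.1.1 & dist p q + s'.1.2 <= s.1.2),
      forall p, p \in s.1.1 -> exists q1 q2,
        [/\ q1 \in s'.1.1, q2 \in s'.1.1, q1 != q2,
            dist p q1 + s'.1.2 <= s.1.2 & dist p q2 + s'.1.2 <= s.1.2] &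
      forall q y, q \in s'.1.1 -> dist q y <= s'.1.2 -> V s'.2 y].
have [||u [u0 uP]] := @dependent_choice_inv _ Inv step ((K0, r0), 0%N).
- by [].
- move=> l [[K r] k]; rewrite /Inv /= => r_gt0.
  have [n nP] : exists n, forall p, p \in K -> forall j, (n <= j)%N ->
      [set y | dist p y < r] `&` V j !=set0.
    elim: K => [|p K [n IH]]; first by exists 0%N.
    have [|m mP] := V_meets (@open_mdist_lt _ X p r).
      by exists p; rewrite /= distxx.
    exists (maxn m n) => q; rewrite inE => /predU1P[->|qK] j.
      by rewrite geq_max => /andP[mj _]; exact: mP.
    by rewrite geq_max => /andP[_ nj]; exact: IH.
  have [j] := E_inf (maxn n k.+1); rewrite geq_max => /andP[nj kj] Ej.
  have [|K' [r' [/andP[r'0 r'rad] sep par chi inV]]] :=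
    @scheme_step K r (rad l) (V j) (rad0 l) (V_open j).
    by move=> p pK; exact: nP.
  by exists ((K', r'), j).
pose K l := (u l).1.1; pose r l := (u l).1.2.
have r_gt0 l : 0 < r l by have [] := uP l.
have r_small d : 0 < d -> exists l, r l < d.
  move=> /radP[l ld]; exists l.+1; apply: lt_trans ld.
  by have [_ []] := uP l.
have K_neq0 : K 0%N != [::] by rewrite /K u0.
have K_sep l p q : p \in K l -> q \in K l -> p != q -> 2 * r l < dist p q.
  case: l => [|l]; last by have [_ [_ _ [+ _] _ _]] := uP l; exact.
  rewrite /K /r u0 /= => pK qK pq; have [|_ h] := r0P (p, q); last exact: h.
  by apply/allpairsP; exists (p, q).
have K_parent l q : q \in K l.+1 ->
    exists2 p, p \in K l & dist p q + r l.+1 <= r l.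
  by have [_ [_ _ [_ +] _ _]] := uP l; exact.
have K_children l p : p \in K l -> exists q1 q2, [/\ q1 \in K l.+1,
    q2 \in K l.+1, q1 != q2, dist p q1 + r l.+1 <= r l &
    dist p q2 + r l.+1 <= r l].
  by have [_ [_ _ _ + _]] := uP l; exact.
have r0e : r 0%N <= e.
  rewrite /r u0 /=.
  case: K0 K00 r0P {uP u0 K K_neq0 K_sep K_parent K_children} => // p s _ h.
  have [|//] := h (p, p); apply/allpairsP; exists (p, p).
  by rewrite mem_head.
exists (scheme_limit K r), [set k | exists l, k = (u l.+1).2]; split.
- exact: scheme_limit_cantor.
- split=> [a /(_ 0%N I)[p]|p pK0].
    by rewrite /K u0 /= => pK0 pa; exists p => //; apply: le_trans r0e.
  have [|a Aa pa] := @scheme_limit_ball _ _ K r r_gt0 r_small K_neq0 K_parent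
      K_children 0 p; first by rewrite /K u0.
  by exists a => //; exact: le_trans r0e.
- move=> n; exists (u n.+1).2; last by exists n.
  elim: n => [|n IH]; first by [].
  by apply: leq_ltn_trans IH _; have [_ [[]]] := uP n.+1.
- by move=> _ [l ->]; have [_ [[]]] := uP l.
- move=> _ [l ->] x /(_ l.+1 I)[p pK px].
  by have [_ [_ _ _ _]] := uP l; apply; [exact: pK|].
Qed.

Hypothesis X_separable : separable X.

(** A finite set of terms of a dense sequence approximates a compact set. *)
Lemma compact_finite_net (d : nat -> X) (K : set X) (e : R) :
  (forall x e, 0 < e -> exists i, dist x (d i) < e) ->
  compact K -> K !=set0 -> 0 < e ->
  exists2 s : seq nat, s != [::] & sets_within e K [set` [seq d i | i <- s]].
Proof.
move=> dP cK [x0 Kx0] e0.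
have [n nP] : exists n, forall x, K x ->
    exists2 j, (j < n)%N & dist x (d j) < e.
  have /compact_near_coveringP cov := cK.
  have [|n _ /(_ n (leqnn n)) nP] := cov nat \oo
      (fun n x => exists2 j, (j < n)%N & dist x (d j) < e) _; last by exists n.
  move=> x Kx; have [|j xj] := dP x (e / 2); first lra.
  exists ([set y | dist x y < e / 2], [set n | (j < n)%N]) => /=.
    split; last by exists j.+1.
    by apply/nbhs_mdist_ex; exists (e / 2) => //; lra.
  move=> [y m] /= [xy jm]; exists j => //.
  by have := dist_triangle y x (d j); rewrite (distC y x); lra.
pose s := [seq j <- iota 0 n | `[< exists2 x, K x & dist x (d j) < e >]].
have sP j : reflect ((j < n)%N /\ exists2 x, K x & dist x (d j) < e) (j \in s).
  rewrite mem_filter mem_iota add0n /=.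
  by apply: (iffP andP) => [[/asboolP]|[jn xj]]; split=> //; apply/asboolP.
exists s.
  have [j jn xj] := nP x0 Kx0; have : j \in s.
    by apply/sP; split=> //; exists x0.
  by case: s sP.
split=> [x Kx|_ /mapP[j /sP[_ [x Kx xj]] ->]].
  have [j jn xj] := nP x Kx; exists (d j); last by rewrite distC ltW.
  by apply/mapP; exists j => //; apply/sP; split=> //; exists x.
by exists x => //; rewrite distC ltW.
Qed.

(** A sequence of Cantor sets, dense for the Hausdorff distance, any finitely
    many of which lie together in infinitely many of the open sets [V k]. *)
Lemma limsup_cantor_sequence : exists A : nat -> set X,
  [/\ forall i, cantor_subset (A i),
      forall (K : set X) e, compact K -> K !=set0 -> 0 < e ->
        exists i, sets_within e (A i) K &
      forall N, infinite_indices [set k | \bigcup_(i < N) A i `<=` V k]].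
Proof.
have [d dP] := separable_sequence X_separable.
have [rad rad0 radP] := small_sequence R.
(* the finite sets to be approximated, with the required precision *)
pose target i : seq X * R :=
  if (unpickle i : option (seq nat * nat)) is Some (j :: s, m)
  then ([seq d t | t <- j :: s], rad m) else ([:: point], 1).
have target_ok i : (target i).1 != [::] /\ 0 < (target i).2.
  by rewrite /target; case: unpickle => [[[|j s] m]|] /=; split; rewrite ?ltr01.
(* A state consists of an infinite set of indices and of the last Cantor set.
   The set of indices shrinks, so that all the Cantor sets chosen up to a given
   rank lie in [V k] for each [k] in the set of indices of that rank. *)
pose step i (s s' : set nat * set X) :=
  [/\ s'.1 `<=` s.1, cantor_subset s'.2,
      sets_within (target i).2 s'.2 [set` (target i).1] &
      forall k, s'.1 k -> s'.2 `<=` V k].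
have [||u [u0 uP]] := @dependent_choice_inv _
    (fun s : set nat * set X => infinite_indices s.1) step (setT, set0).
- by move=> n; exists n.
- move=> i [E A] /= E_inf; have [t1 t2] := target_ok i.
  have [A' [E' [cA' AK E'_inf E'E E'V]]] := limsup_cantor E_inf t1 t2.
  by exists (E', A').
have E_le i j : (i <= j)%N -> (u j).1 `<=` (u i).1.
  elim: j => [|j IH]; first by rewrite leqn0 => /eqP ->.
  rewrite leq_eqVlt => /predU1P[->//|/IH]; apply: subset_trans.
  by have [_ []] := uP j.
exists (fun i => (u i.+1).2); split.
- by move=> i; have [_ []] := uP i.
- move=> K e cK K0 e0.
  have e20 : 0 < e / 2 by lra.
  have [[//|j s] _ [Ks sK]] := compact_finite_net dP cK K0 e20.
  have [m me] := radP _ e20; exists (pickle (j :: s, m)).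
  have [_ [_ _ + _]] := uP (pickle (j :: s, m)).
  rewrite /target pickleK /= => -[h1 h2]; split.
  + move=> a /h1[b bs ba]; have [x Kx bx] := sK b bs.
    by exists x => //; have := dist_triangle x b a; rewrite (distC x b); lra.
  + move=> x /Ks[b bs bx]; have [a Aa ba] := h2 b bs.
    by exists a => //; have := dist_triangle x b a; rewrite (distC x b); lra.
- move=> N n; have [u_inf _] := uP N; have [k nk uk] := u_inf n.
  exists k => //= x [i /= iN]; have [_ [_ _ _ h]] := uP i; apply: h.
  exact: E_le uk.
Qed.

End cantor_sequence.

(** * Countable intersections and finite powers *)

Lemma Gdelta_bigcap (T : topologicalType) (S : nat -> set T) :
  (forall n, Gdelta (S n)) -> Gdelta (\bigcap_n S n).
Proof.
move=> SG; have /choice[F FP] : forall n, exists F : nat -> set T,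
    (forall i, open (F i)) /\ S n = \bigcap_i F i.
  by move=> n; have [F oF SF] := SG n; exists F.
exists (fun m => if (unpickle m : option (nat * nat)) is Some (n, i)
                 then F n i else setT).
  by move=> m; case: unpickle => [[n i]|]; [have [] := FP n|exact: openT].
apply/seteqP; split=> [x Sx m _|x Fx n _].
  by case: unpickle => [[n i]|//]; have := Sx n I; have [_ ->] := FP n; exact.
have [_ ->] := FP n => i _.
by have := Fx (pickle (n, i)) I; rewrite pickleK.
Qed.

Lemma Gdelta_preimage (T U : topologicalType) (g : T -> U) (S : set U) :
  continuous g -> Gdelta S -> Gdelta (g @^-1` S).
Proof.
move=> cg [F oF ->].
exists (fun i => g @^-1` F i); last by rewrite preimage_bigcap.
by move=> i; apply: open_comp => // x _; exact: cg.
Qed.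

Section finite_powers.
Variables (R : realType) (X : metricType R) (n : nat).

Lemma power_box_open (U : 'I_n -> set X) : (forall i, open (U i)) ->
  open [set x : power X n | forall i, U i (x i)].
Proof.
move=> oU; rewrite openE => x Ux.
have : nbhs x [set y : power X n | forall i, U i (y i)].
  apply: (@filter_forall _ 'I_n (fun i y => U i (y i)) (nbhs x)) => i.
  apply: (@proj_continuous _ (fun _ : 'I_n => X) i x); apply: open_nbhs_nbhs.
  by split; [exact: oU|exact: Ux].
exact.
Qed.

(** As there are finitely many coordinates, the boxes with equal sides form a
    base of neighbourhoods. *)
Lemma power_nbhs_box (x : power X n) (W : set (power X n)) : nbhs x W ->
  exists2 e : R, 0 < e & forall y : power X n,
    (forall i, dist (x i) (y i) < e) -> W y.
Proof.
pose B (e : R) := [set y : power X n | forall i, dist (x i) (y i) < e].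
pose F := filter_from [set e : R | 0 < e] B.
have FF : Filter F.
  apply: filter_from_filter; first by exists 1; exact: ltr01.
  move=> e e' e0 e'0; exists (Num.min e e') => /=.
    by rewrite lt_min; apply/andP.
  move=> y By; split=> i; have : dist (x i) (y i) < Num.min e e' := By i.
    by rewrite lt_min => /andP[].
  by rewrite lt_min => /andP[].
have Fx : F --> x.
  apply/cvg_sup => i N [? [[W' oW' <-] /= W'x] W'N].
  have [e e0 eW'] := open_mdist_ex oW' W'x.
  by exists e => // y By; apply/W'N/eW'; exact: By.
by move=> /Fx[e e0 eW]; exists e.
Qed.

End finite_powers.

(** * Cardinality of Cantor sets *)

Section cardinality.

Lemma injective_card_le (T U : Type) (g : T -> U) : injective g ->
  ([set: T] #<= [set: U])%card.
Proof.
move=> g_inj; have := @inj_card_eq _ _ setT g.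
move=> /(_ (fun x y _ _ => @g_inj x y)); rewrite card_eq_le => /andP[_ h].
by apply: card_le_trans h _; exact: subset_card_le.
Qed.

Lemma homeomorphic_card (T U : topologicalType) :
  homeomorphic T U -> ([set: T] #<= [set: U])%card.
Proof. by move=> [g [h [_ _ gK _]]]; exact/injective_card_le/can_inj/gK. Qed.

(** A real number is determined by its Dedekind cut. *)
Lemma real_card_le (R : realType) :
  ([set: R] #<= [set: cantor_space])%card.
Proof.
pose g (x : R) : cantor_space := fun k =>
  if unpickle k is Some q then (ratr q < x)%R else false.
apply: (@injective_card_le _ _ g).
have g_lt x y : (x < y)%R -> g x <> g y.
  move=> xy gxy; have [q] := rat_in_itvoo xy; rewrite in_itv /= => /andP[xq qy].
  have := congr1 (fun h : cantor_space => h (pickle q)) gxy.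
  by rewrite /g pickleK qy ltNge (ltW xq).
by move=> x y gxy; have [/g_lt|/g_lt/nesym|//] := ltgtP x y.
Qed.

(** A point is determined by the members of a countable base that contain it. *)
Lemma separable_card_le (R : realType) (X : completeMetricType R) :
  separable X -> ([set: X] #<= [set: cantor_space])%card.
Proof.
move=> /countable_open_base[B [_ _ Bbase]].
apply: (@injective_card_le _ _
  (fun x => (fun k => `[< B k x >]) : cantor_space)).
move=> x y xy; apply/eqP/negPn/negP; rewrite -dist_gt0 => dxy.
have [||j Bx Bxy] := Bbase [set z | dist x z < dist x y] x.
- exact: open_mdist_lt.
- by rewrite /= distxx.
have : `[< B j y >].
  by rewrite -(congr1 (fun h : cantor_space => h j) xy); exact/asboolP.
by move=> /asboolP/Bxy /=; rewrite ltxx.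
Qed.

(** A subset of a separable space that contains a Cantor set has the cardinality
    of the continuum. *)
Lemma cantor_card_continuum (R : realType) (X : completeMetricType R)
    (A B : set X) :
  separable X -> cantor_subset A -> A `<=` B -> (B #= [set: R])%card.
Proof.
move=> sX cA AB; rewrite card_eq_le; apply/andP; split.
  apply: card_le_trans (subset_card_le (@subsetT _ B)) _.
  apply: card_le_trans (separable_card_le sX) _.
  have /homeomorphic_card h := cantor_subset_homeomorphic
    (@Rhausdorff R) (middle_third_cantor_subset R).
  apply: card_le_trans h _; rewrite (card_le_eql (card_setT _)).
  exact/subset_card_le/subsetT.
apply: card_le_trans (real_card_le R) _.
have /homeomorphic_card h :=
  cantor_subset_homeomorphic (@metric_hausdorff R X) cA.
apply: card_le_trans h _; rewrite (card_le_eql (card_setT _)).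
exact: subset_card_le.
Qed.

End cardinality.

(** * The equivalences *)

Section equivalences.
Variables (R : realType) (X : completeMetricType R).
Hypotheses (X_separable : separable X) (X_perfect : isolated [set: X] = set0).
Variable f : X -> X.
Hypothesis f_continuous : continuous f.
Variable Q : set (compacts X).
Hypotheses (Q_Gdelta : Gdelta Q) (Q_hereditary : hereditary Q).

Lemma orbits_in_sub (A B : set X) : orbits_in f Q B -> compact A -> A !=set0 ->
  A `<=` B -> orbits_in f Q A.
Proof.
move=> QB cA nA AB N; apply: (in_family_sub Q_hereditary (QB N)).
- exact: orbit_upto_compact.
- exact: orbit_upto_nonempty.
- exact: orbit_upto_sub.
Qed.

(** The partial orbit of length [0] is controlled by heredity. *)
Lemma orbits_inE (A : set X) : compact A -> A !=set0 ->
  (forall N, (1 <= N)%N -> in_family Q (orbit_upto f N A)) <-> orbits_in f Q A.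
Proof.
move=> cA nA; split=> [h [|N]|h N _]; [|exact: h|exact: h].
apply: (in_family_sub Q_hereditary (h 1%N isT)).
- exact: orbit_upto_compact.
- exact: orbit_upto_nonempty.
- exact: orbit_upto_le.
Qed.

(** The set of the first statement: the compact sets with all partial orbits in
    [Q]. *)
Definition orbits_in_compacts := [set A : compacts X |
  forall N, (1 <= N)%N -> in_family Q (orbit_upto f N A)].

Lemma orbits_in_compactsE (A : compacts X) :
  orbits_in_compacts A <-> orbits_in f Q A.
Proof.
exact: (orbits_inE (@carrier_compact _ A) (@carrier_nonempty _ A)).
Qed.

Lemma orbits_in_compacts_Gdelta : Gdelta orbits_in_compacts.
Proof.
suff -> : orbits_in_compacts =
    \bigcap_N (orbit_compacts f_continuous N @^-1` Q).
  apply: Gdelta_bigcap => N; apply: Gdelta_preimage => //.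
  exact: orbit_compacts_continuous.
apply/seteqP; split=> A.
  move=> /orbits_in_compactsE QA N _.
  by rewrite /preimage /= -in_familyE; exact: QA.
move=> QA; apply/orbits_in_compactsE => N.
by have := QA N I; rewrite /preimage /= -in_familyE.
Qed.

Lemma range_compact n (x : 'I_n -> X) : compact (range x).
Proof. by apply: finite_compact; exact/finite_image/finite_finset. Qed.

Lemma range_nonempty n (x : 'I_n.+1 -> X) : range x !=set0.
Proof. by exists (x ord0), ord0. Qed.

(** The compact set of the coordinates of a nonempty tuple. *)
Definition range_compacts n (x : power X n.+1) : compacts X :=
  Compacts (@range_compact n.+1 x) (range_nonempty x).

(** By this continuity, the set of the third statement is [Gdelta] as soon as
    that of the first one is: it is its preimage. *)
Lemma range_compacts_continuous n :
  continuous (@range_compacts n : power X n.+1 -> compacts X).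
Proof.
move=> x U /nbhs_mdist_ex[e e0 eU].
have : open [set y : power X n.+1 | forall i, dist (x i) (y i) < e / 2].
  apply: (@power_box_open _ _ _ (fun i => [set z | dist (x i) z < e / 2])) => i.
  exact: open_mdist_lt.
move=> oB.
have : nbhs x [set y : power X n.+1 | forall i, dist (x i) (y i) < e / 2].
  by apply: open_nbhs_nbhs; split=> // i /=; rewrite distxx; lra.
apply: filterS => y xy; apply: eU; apply: (@le_lt_trans _ _ (e / 2)); last lra.
apply: hausdorff_le => /= _ [i _ <-].
  by exists (y i); [exists i|exact: ltW].
by exists (x i); [exists i|rewrite distC; exact: ltW].
Qed.

Section from_finite_orbits.
Hypothesis Q_dense : finite_orbits_dense f Q.

Lemma orbits_in_compacts_dense : dense orbits_in_compacts.
Proof.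
move=> W [K WK] oW; have [e e0 eW] := open_mdist_ex oW WK.
have [d dP] := separable_sequence X_separable.
have [|[//|j s] _ [Ks sK]] :=
    compact_finite_net dP (@carrier_compact _ K) (@carrier_nonempty _ K)
      (e := e / 3).
  lra.
pose c (i : 'I_(size s).+1) := d (nth 0%N (j :: s) i).
have [i|x xc Qx] := Q_dense (U := fun i => [set y | dist (c i) y < e / 3]).
  split; first exact: open_mdist_lt.
  by exists (c i); rewrite /= distxx; lra.
have c_in i : [set` [seq d i | i <- j :: s]] (c i).
  by apply/mapP; exists (nth 0%N (j :: s) i) => //; exact: mem_nth.
exists (range_compacts x); split; last exact/orbits_in_compactsE.
apply: eW; apply: (@le_lt_trans _ _ (e * 2 / 3)); last lra.
apply: hausdorff_le => /=.
  move=> a /Ks[b /mapP[t ts ->] ba].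
  have ti : (index t (j :: s) < (size s).+1)%N by rewrite index_mem.
  exists (x (Ordinal ti)); first by exists (Ordinal ti).
  have /= := xc (Ordinal ti); rewrite /c nth_index// => cx.
  have := dist_triangle a (d t) (x (Ordinal ti)).
  by rewrite (distC a (d t)); lra.
move=> _ [i _ <-]; have [a Ka ca] := sK _ (c_in i); exists a => //.
have /= := xc i; have := dist_triangle (x i) (c i) a.
by rewrite (distC (x i) (c i)); lra.
Qed.

Lemma orbits_in_power_dense n : dense
  [set x : power X n.+1 |
    forall N, (1 <= N)%N -> in_family Q (orbit_upto f N (range x))].
Proof.
move=> W [u Wu] oW.
have [e e0 eW] := power_nbhs_box (open_nbhs_nbhs (conj oW Wu)).
have [i|x xu Qx] := Q_dense (U := fun i => [set y | dist (u i) y < e]).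
  split; first exact: open_mdist_lt.
  by exists (u i); rewrite /= distxx.
by exists x; split; [exact: eW|move=> N _; exact: Qx].
Qed.

(** A dense sequence of Cantor sets with the required finite unions. *)
Lemma cantor_sequence_orbits_in : exists A : nat -> set X,
  [/\ forall i, cantor_subset (A i),
      forall (K : set X) e, compact K -> K !=set0 -> 0 < e ->
        exists i, sets_within e (A i) K &
      forall N, orbits_in f Q (\bigcup_(i < N.+1) A i)].
Proof.
have [V [oV Vmeets VQ]] :=
  general_position X_separable f_continuous Q_Gdelta Q_hereditary Q_dense.
have [G oG G0|A [cA dA AV]] :=
  limsup_cantor_sequence X_perfect oV _ X_separable.
  have [n nP] := Vmeets G oG G0; exists n => k nk.
  have [x Gx Vx] := nP k.+1; exists x; split=> //.
  by apply: Vx; rewrite nk ltnSn.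
exists A; split=> // N; apply: VQ.
- rewrite bigcup_mkord; apply: bigsetU_compact => i _.
  by have [] := cA i.
- by have [_ [x Ax] _ _] := cA 0%N; exists x; exists 0%N.
- by move=> n; have [k nk AVk] := AV N.+1 n; exists k.
Qed.

Lemma dense_cantor_sets_sequence :
  exists A : nat -> cantor_sets R X, dense (range A) /\
  forall N, (1 <= N)%N -> in_family Q (\bigcup_(j < N.+1) \bigcup_(i < N)
                       (iter j f @` (val (A i) : set X))).
Proof.
have [A [cA dA QA]] := cantor_sequence_orbits_in.
have nA i : A i !=set0 by have [] := cA i.
have kA i : compact (A i) by have [] := cA i.
pose K i : compacts X := Compacts (kA i) (nA i).
have hK i : cantor_sets R X (K i).
  apply: homeomorphic_trans (cantor_subset_homeomorphic (@Rhausdorff R)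
    (middle_third_cantor_subset R)).
  apply: homeomorphic_sym; apply: cantor_subset_homeomorphic (cA i).
  exact: metric_hausdorff.
exists (fun i => exist _ (K i) (mem_set (hK i))); split.
- move=> W [L WL] [W' oW' W'W].
  have W'L : W' (val L) by move: WL; rewrite -W'W /= set_valE.
  have [e e0 eW'] := open_mdist_ex oW' W'L.
  have [||i [AL LA]] := dA (val L : set X) (e / 2) (@carrier_compact _ (val L)).
  + exact: carrier_nonempty.
  + lra.
  exists (exist _ (K i) (mem_set (hK i))); split; last by exists i.
  rewrite -W'W /= set_valE /=; apply: eW'.
  apply: (@le_lt_trans _ _ (e / 2)); last lra.
  apply: hausdorff_le => /= [a /LA[b Ab ab]|b /AL[a La ab]].
    by exists b.
  by exists a => //; rewrite distC.
- move=> [//|N] _; have := QA N N.+1; rewrite /orbit_upto.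
  congr in_family; apply: eq_bigcupr => j _.
  by rewrite image_bigcup.
Qed.

Lemma orbit_upto_image N (A : set X) :
  f @` orbit_upto f N A `<=` orbit_upto f N.+1 A.
Proof.
move=> _ [_ [i iN [a Aa <-]] <-]; exists i.+1 => //=.
by exists a.
Qed.

Lemma exists_c_dense_dependent : exists A : set X,
  [/\ c_dense R A, Fsigma A, invariant_set f A &
      dependent_set (coherent_list Q) A].
Proof.
have [A [cA dA QA]] := cantor_sequence_orbits_in.
pose F n := orbit_upto f n (\bigcup_(i < n.+1) A i).
have F_le m n : (m <= n)%N -> F m `<=` F n.
  move=> mn; apply: subset_trans (@orbit_upto_le _ f _ _ _ mn).
  apply: orbit_upto_sub => x [i /= im Aix]; exists i => //=.
  exact: leq_trans im _.
exists (\bigcup_n F n); split.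
- move=> U oU [u Uu]; have [e e0 eU] := open_mdist_ex oU Uu.
  have [||i [iu _]] := dA [set u] (e / 2) (@compact_set1 _ u).
  + by exists u.
  + lra.
  apply: cantor_card_continuum X_separable (cA i) _ => a Aa; split.
    by exists i => //; apply: sub_orbit_upto; exists i => /=.
  by apply: eU; have [_ -> ua] := iu a Aa; lra.
- exists F => // n; apply: compact_metric_closed.
  apply: orbit_upto_compact => //.
  rewrite bigcup_mkord; apply: bigsetU_compact => i _.
  by have [] := cA i.
- move=> _ [a [n _ Fa] <-]; exists n.+1 => //.
  have : orbit_upto f n.+1 (\bigcup_(i < n.+1) A i) (f a).
    by apply: orbit_upto_image; exists a.
  apply: orbit_upto_sub => x [i /= im Aix]; exists i => //=.
  exact: leq_trans im _.
- move=> [//|n] x _ _ xA.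
  have /choice[m mP] : forall i, exists m, F m (x i).
    by move=> i; have [m _] := xA i; exists m.
  pose M := \max_(i < n.+1) m i.
  apply: (in_family_sub Q_hereditary (QA M M)).
  + exact: range_compact.
  + exact: range_nonempty.
  + by move=> _ [i _ <-]; apply: (@F_le (m i)) => //; exact: (leq_bigmax i).
Qed.

Lemma exists_nowhere_meager_dependent : exists A : set X,
  [/\ nowhere_meager A, invariant_set f A & dependent_set (coherent_list Q) A].
Proof.
have [V [oV Vmeets VQ]] :=
  general_position X_separable f_continuous Q_Gdelta Q_hereditary Q_dense.
have [U [UU ooU]] := @ultraFilterLemma nat \oo _.
(* [A] need not be invariant, but the union of its images is, and it is still
   dependent because the [V k] control whole orbits. *)
pose A := [set x | U [set k | V k x]].
exists (\bigcup_i (iter i f @` A)); split.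
- move=> W oW W0 [F F_nd AWF].
  have [x [Wx Ax Fx]] := ultra_limit_nowhere_meager oV Vmeets UU ooU oW W0 F_nd.
  have : ((\bigcup_i (iter i f @` A)) `&` W) x.
    by split=> //; exists 0%N => //; exists x.
  by rewrite AWF => -[n _]; exact: Fx.
- by move=> _ [_ [i _ [x Ax <-]] <-]; exists i.+1 => //; exists x.
- move=> [//|n] y _ _ yA.
  have /choice[m mP] : forall i, exists m, exists2 x, A x & iter m f x = y i.
    by move=> i; have [m _ [x Ax xy]] := yA i; exists m, x.
  have /choice[x xP] : forall i, exists x, A x /\ iter (m i) f x = y i.
    by move=> i; have [x Ax xy] := mP i; exists x.
  pose M := \max_(i < n.+1) m i.
  have Qx : orbits_in f Q (range x).
    apply: VQ; [exact: range_compact|exact: range_nonempty|move=> k0].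
    have Uk : U [set k | forall i, V k (x i)].
      apply: (@filter_forall _ 'I_n.+1 (fun i k => V k (x i)) U) => i.
      by have [] := xP i.
    have Uk0 : U [set k | (k0 <= k)%N] by apply: ooU; exists k0.
    have [k [Vk k0k]] := @filter_ex _ U _ _ (filterI Uk Uk0).
    by exists k => // _ [i _ <-]; exact: Vk.
  apply: (in_family_sub Q_hereditary (Qx M)).
  + exact: range_compact.
  + exact: range_nonempty.
  + move=> _ [i _ <-]; exists (m i).
      by rewrite /= ltnS; exact: (leq_bigmax i).
    by exists (x i); [exists i|have [] := xP i].
Qed.

End from_finite_orbits.

Lemma finite_orbits_dense_compacts :
  dense orbits_in_compacts -> finite_orbits_dense f Q.
Proof.
move=> Q_dense n U U_ok.
have /choice[u uP] : forall i, exists x, U i x by move=> i; have [_] := U_ok i.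
have [e e0 eP] : exists2 e : R, 0 < e & forall i, i \in enum 'I_n.+1 ->
    forall y, dist (u i) y < e -> U i y.
  apply: finite_threshold => [i e e' he _ e'e y uy|i _].
    by apply: he; exact: lt_le_trans e'e.
  by apply: open_mdist_ex => //; have [] := U_ok i.
have [||A [uA /orbits_in_compactsE QA]] :=
  Q_dense [set A | dist (range_compacts u) A < e].
- by exists (range_compacts u); rewrite /= distxx.
- exact: open_mdist_lt.
have /choice[x xP] : forall i, exists x, (A : set X) x /\ dist (u i) x < e.
  move=> i; have [|x Ax ux] := hausdorff_lt uA (a := u i); first by exists i.
  by exists x.
exists x => [i|]; first by have [_ /eP] := xP i; apply; rewrite mem_enum.
apply: orbits_in_sub QA _ _ _; [exact: range_compact|exact: range_nonempty|].
by move=> _ [i _ <-]; have [] := xP i.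
Qed.

Lemma finite_orbits_dense_power :
  (forall n, dense [set x : power X n.+1 |
     forall N, (1 <= N)%N -> in_family Q (orbit_upto f N (range x))]) ->
  finite_orbits_dense f Q.
Proof.
move=> Q_dense n U U_ok.
have /choice[u uP] : forall i, exists x, U i x by move=> i; have [_] := U_ok i.
have [||x [xU Qx]] := Q_dense n [set x : power X n.+1 | forall i, U i (x i)].
- by exists u.
- by apply: power_box_open => i; have [] := U_ok i.
exists x => //; apply/orbits_inE => //; first exact: range_compact.
exact: range_nonempty.
Qed.

(** Every nonempty open set contains a Cantor set, so that a dense sequence of
    Cantor sets has a dense union. *)
Lemma cantor_dense_meets (A : nat -> cantor_sets R X) (G : set X) :
  dense (range A) -> open G -> G !=set0 ->
  exists i, exists2 x, (val (A i) : set X) x & G x.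
Proof.
move=> dA oG [c Gc]; have [e e0 eG] := open_mdist_ex oG Gc.
have e20 : 0 < e / 2 by lra.
have [||||C [_ [cC [Cc _] _ _ _]]] := @limsup_cantor R X X_perfect (fun=> setT)
    _ _ setT [:: c] (e / 2) _ _ e20.
- by move=> _; exact: openT.
- by move=> W oW [x Wx]; exists 0%N => k _; exists x.
- by move=> n; exists n.
- by [].
have [kC nC _ _] := cC; pose K : compacts X := Compacts kC nC.
have hK : cantor_sets R X K.
  apply: homeomorphic_trans (cantor_subset_homeomorphic (@Rhausdorff R)
    (middle_third_cantor_subset R)).
  apply: homeomorphic_sym; apply: cantor_subset_homeomorphic cC.
  exact: metric_hausdorff.
have [||z [KA [i _ Ai]]] := dA (set_val @^-1` [set L | dist K L < e / 2]).
- by exists (exist _ K (mem_set hK)); rewrite /preimage /= set_valE /= distxx.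
- by exists [set L | dist K L < e / 2] => //; exact: open_mdist_lt.
have {}KA : dist K (val (A i)) < e / 2.
  by move: KA; rewrite -Ai /preimage /= set_valE.
have [x Cx] := nC; have [a Aa xa] := hausdorff_lt KA Cx.
exists i, a => //; apply: eG; have [b /= bc bx] := Cc x Cx.
move: bc bx; rewrite inE => /eqP -> cx.
by have := dist_triangle c x a; lra.
Qed.

Lemma finite_orbits_dense_cantor (A : nat -> cantor_sets R X) :
  dense (range A) ->
  (forall N, (1 <= N)%N -> in_family Q (\bigcup_(j < N.+1) \bigcup_(i < N)
                       (iter j f @` (val (A i) : set X)))) ->
  finite_orbits_dense f Q.
Proof.
move=> dA QA n U U_ok.
have /choice[t tP] : forall i,
    exists t, exists2 x, (val (A t) : set X) x & U i x.
  by move=> i; have [oU nU] := U_ok i; exact: cantor_dense_meets.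
have /choice[x xP] : forall i, exists x, (val (A (t i)) : set X) x /\ U i x.
  by move=> i; have [x Ax Ux] := tP i; exists x.
exists x => [i|N]; first by have [] := xP i.
pose M := maxn N (\max_(i < n.+1) t i).+1.
have M_gt0 : (1 <= M)%N by rewrite leq_max orbT.
apply: (in_family_sub Q_hereditary (QA M M_gt0)).
- exact/orbit_upto_compact/range_compact.
- exact/orbit_upto_nonempty/range_nonempty.
- move=> _ [j /= jN [_ [i _ <-] <-]].
  exists j; first by rewrite /= ltnS (leq_trans _ (leq_maxl N _)).
  exists (t i); last by exists (x i) => //; have [] := xP i.
  rewrite /= /M (leq_trans _ (leq_maxr N _))// ltnS.
  exact: (leq_bigmax i).
Qed.

(** Finite nonempty subsets of a dependent set belong to the family: their
    points can be listed without repetition. *)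
Lemma dependent_finite (D L : set X) : dependent_set (coherent_list Q) D ->
  finite_set L -> L !=set0 -> L `<=` D -> in_family Q L.
Proof.
move=> depD /finite_seqP[s ->] [y ys] sD.
pose x : power X (size (undup s)) := fun i => nth y (undup s) i.
have x_in i : x i \in s by rewrite -mem_undup mem_nth.
have <- : range x = [set` s].
  apply/seteqP; split=> [_ [i _ <-]|z zs] //=.
  have zi : (index z (undup s) < size (undup s))%N.
    by rewrite index_mem mem_undup.
  by exists (Ordinal zi) => //; rewrite /x nth_index// mem_undup.
apply: depD => [|i j /eqP|i]; last exact/sD/x_in.
  have : y \in undup s by rewrite mem_undup.
  by case: (undup s).
by rewrite nth_uniq ?undup_uniq// => /eqP/val_inj.
Qed.

Lemma finite_orbits_dense_dependent (D : set X) :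
  dense D -> invariant_set f D -> dependent_set (coherent_list Q) D ->
  finite_orbits_dense f Q.
Proof.
move=> dD fD depD n U U_ok.
have /choice[x xP] : forall i, exists x, U i x /\ D x.
  by move=> i; have [oU nU] := U_ok i; exact: dD.
exists x => [i|N]; first by have [] := xP i.
apply: dependent_finite depD _ _ _.
- apply: bigcup_finite => [|i _]; first exact: finite_II.
  exact/finite_image/finite_image/finite_finset.
- exact/orbit_upto_nonempty/range_nonempty.
- move=> _ [j _ [_ [i _ <-] <-]]; elim: j => [|j IH]; first by have [] := xP i.
  by apply: fD; exists (iter j f (x i)).
Qed.

Lemma c_dense_dense (D : set X) : c_dense R D -> dense D.
Proof.
move=> cD U U0 oU; have := cD U oU U0; rewrite setIC => DU.
apply/set0P/eqP => DU0; move: DU; rewrite DU0 card_eq_sym card_eq0.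
by move=> /eqP RT; have : [set: R] 0 by []; rewrite RT.
Qed.

Lemma nowhere_meager_dense (D : set X) : nowhere_meager D -> dense D.
Proof.
move=> mD U U0 oU; apply: contrapT => DU0; apply: (mD U oU U0).
exists (fun=> set0).
  by move=> _; rewrite /nowhere_dense closure0 interior0.
apply/seteqP; split=> x; last by move=> [].
by move=> [Dx Ux]; exfalso; apply: DU0; exists x.
Qed.

(** A dense set has a countable dense subset, whose forward orbits remain in
    any invariant set that contains it. *)
Lemma dense_countable_invariant (D : set X) : dense D -> invariant_set f D ->
  exists A : set X, [/\ dense A, countable A, invariant_set f A & A `<=` D].
Proof.
move=> dD fD; have [B [oB B0 Bbase]] := countable_open_base X_separable.
have /choice[y yP] : forall j, exists y, B j y /\ D y by move=> j; exact: dD.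
exists (\bigcup_i (iter i f @` range y)); split.
- move=> U [x Ux] oU; have [j Bjx BjU] := Bbase U x oU Ux.
  exists (y j); split; first by apply: BjU; have [] := yP j.
  by exists 0%N => //; exists (y j) => //; exists j.
- apply: bigcup_countable => // i _.
  by do 2 apply: card_le_trans (card_image_le _ _) _; exact: card_lexx.
- by move=> _ [_ [i _ [x xy <-]] <-]; exists i.+1 => //; exists x.
- move=> _ [i _ [_ [j _ <-] <-]]; elim: i => [|i IH]; first by have [] := yP j.
  by apply: fD; exists (iter i f (y j)).
Qed.

End equivalences.

Theorem theorem1p2 (R : realType) (X : completeMetricType R)
    (d_bounded : bounded_metric X)
    (X_separable : separable X)
    (X_perfect : isolated [set: X] = set0)
    (f : X -> X) (f_continuous : continuous f)
    (Q : set (compacts X)) (Q_Gdelta : Gdelta Q) (Q_hereditary : hereditary Q) :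
  [<->
    let S := [set A : compacts X | forall N, (1 <= N)%N ->
                in_family Q (\bigcup_(i < N.+1) (iter i f @` (A : set X)))] in
    dense S /\ Gdelta S;
    (* [A i] is the term of index [i + 1] of the sequence *)
    exists A : nat -> cantor_sets R X,
      dense (range A) /\
      forall N, (1 <= N)%N ->
        in_family Q (\bigcup_(j < N.+1) \bigcup_(i < N)
                       (iter j f @` (val (A i) : set X)));
    forall n, (1 <= n)%N ->
      let S := [set x : power X n | forall N, (1 <= N)%N ->
                  in_family Q (\bigcup_(i < N.+1) (iter i f @` range x))] in
      dense S /\ Gdelta S;
    exists A : set X, [/\ dense A, countable A, invariant_set f A &
                          dependent_set (coherent_list Q) A];
    exists A : set X, [/\ c_dense R A, Fsigma A, invariant_set f A &
                          dependent_set (coherent_list Q) A];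
    exists A : set X, [/\ nowhere_meager A, invariant_set f A &
                          dependent_set (coherent_list Q) A]].
Proof.
tfae.
- move=> [/(finite_orbits_dense_compacts f_continuous Q_hereditary) fin _].
  exact: dense_cantor_sets_sequence.
- move=> [A [dA QA]] [//|n] _.
  have fin :=
    finite_orbits_dense_cantor X_perfect f_continuous Q_hereditary dA QA.
  split; first exact: orbits_in_power_dense.
  rewrite [X in Gdelta X](_ : _ =
    @range_compacts R X n @^-1` orbits_in_compacts f Q)//.
  apply: Gdelta_preimage; first exact: range_compacts_continuous.
  exact: (orbits_in_compacts_Gdelta f_continuous).
- move=> QS.
  have fin := finite_orbits_dense_power f_continuous Q_hereditary
    (fun n => (QS n.+1 isT).1).
  have [A [/c_dense_dense dA _ fA depA]] :=
    exists_c_dense_dependent X_separable X_perfect f_continuous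
      Q_Gdelta Q_hereditary fin.
  have [B [dB cB fB BA]] := dense_countable_invariant X_separable dA fA.
  by exists B; split=> // n x n0 x_inj xB; apply: depA => // i; exact: BA.
- move=> [A [dA _ fA depA]].
  have fin := finite_orbits_dense_dependent dA fA depA.
  exact: exists_c_dense_dependent.
- move=> [A [/c_dense_dense dA _ fA depA]].
  have fin := finite_orbits_dense_dependent dA fA depA.
  exact: exists_nowhere_meager_dependent.
- move=> [A [/nowhere_meager_dense dA fA depA]].
  have fin := finite_orbits_dense_dependent dA fA depA.
  split; first exact: orbits_in_compacts_dense.
  exact: orbits_in_compacts_Gdelta.
Qed.
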